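(* Let $(V,Q)$ be a nondefective quadratic space of finite dimension over a field $K$ of arbitrary characteristic. Then all reversible elements of $\mathrm{SO}(V,Q)$ are bireflectional: if $\varphi \in \mathrm{SO}(V,Q)$ is conjugate to $\varphi^{-1}$ in $\mathrm{SO}(V,Q)$, then $\varphi$ is a product of 2 involutions of $\mathrm{SO}(V,Q)$.
   Context: $Q$ is a quadratic form on $V$ with associated bilinear form $f_Q(u,w)=Q(u+w)-Q(u)-Q(w)$; $Q$ is nondefective if $f_Q$ is nondegenerate. $\mathrm{O}(V,Q)$ is the orthogonal group, and $\mathrm{SO}(V,Q)$ is the subgroup of all $\varphi\in \mathrm{O}(V,Q)$ such that the dimension of the image of $\varphi-1$ is even. An involution is an element $\sigma$ with $\sigma^2=1$ (the identity is allowed). An element of a group $G$ is reversible if it is conjugate in $G$ to its inverse, and bireflectional if it is a product of 2 involutions of $G$. *)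

(* Defs.v *)
From mathcomp Require Import all_boot all_order all_algebra.
From mathcomp Require Import sesquilinear.

Set Implicit Arguments.
Unset Strict Implicit.
Unset Printing Implicit Defensive.

Import GRing.Theory.
Local Open Scope ring_scope.

Section QuadraticForm.
Variables (K : fieldType) (V : vectType K).
Implicit Types (Q : V -> K) (phi : 'End(V)).

Definition polar Q (u w : V) : K := Q (u + w) - Q u - Q w.

Definition quadratic_form Q : Prop :=
  (forall (a : K) (v : V), Q (a *: v) = a ^+ 2 * Q v)
  /\ bilinear_for *%R *%R (polar Q).

Definition nondefective Q : Prop :=
  forall u : V, (forall w : V, polar Q u w = 0) -> u = 0.

(* Elements of the groups below are linear endomorphisms with trivial kernel;
   for these (phi^-1)%VF, in general only a partial inverse, is the two-sided
   inverse. *)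
Definition orthogonal_group Q phi : Prop :=
  lker phi = 0%VS /\ forall v : V, Q (phi v) = Q v.

Definition special_orthogonal_group Q phi : Prop :=
  orthogonal_group Q phi /\ ~~ odd (\dim (limg (phi - \1%VF))).

End QuadraticForm.

(* A group of linear automorphisms of V is given by its membership predicate
   G. *)
Section LinearGroup.
Variables (K : fieldType) (V : vectType K) (G : 'End(V) -> Prop).
Implicit Types phi psi sigma tau : 'End(V).

(* The identity counts as an involution. *)
Definition involution_in sigma : Prop :=
  G sigma /\ (sigma \o sigma)%VF = \1%VF.

Definition reversible_in phi : Prop :=
  exists2 psi, G psi & (psi \o phi \o psi^-1)%VF = (phi^-1)%VF.

Definition bireflectional_in phi : Prop :=
  exists sigma tau,
    [/\ involution_in sigma, involution_in tau & phi = (sigma \o tau)%VF].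

End LinearGroup.

(* Main.v *)
(* The parity of dim im (g - 1) is a homomorphism on O(V, Q): for isometries a
   and b the form f(v - w, (a - 1) v'), where (b - 1) w = (a - 1) v, is
   alternating and its rank compares the three dimensions dim im (a - 1),
   dim im (b - 1) and dim im (a - b).

   In O(V, Q) every phi is inverted by an involution: V splits into
   nondegenerate phi-stable summands with one or two generators, on each of
   which the semilinear extension (phi -> phi^-1) of a suitable permutation of
   the generators is an isometry.  The parity of this involution is the issue.

   Put N = phi - 1. If N^(2m+1) v = 0 implies Q(N^m v) = 0, and likewise for
   -phi, then the centralizer of phi lies in SO(V, Q): on the generalized
   eigenspaces for 1 and -1 the sum of the spaces N^m (ker N^(2m+1)) is a
   canonical Lagrangian, and on the rest of V the Wall form of an element c of
   the centralizer is a phi-invariant nondegenerate form on im (c - 1), which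
   forces dim im (c - 1) to be even as phi has no eigenvalue 1 or -1.  So all
   the elements inverting phi have the same parity, which is even if phi is
   reversible in SO(V, Q).  Otherwise a vector v with N^(2m+1) v = 0 and
   Q(N^m v) <> 0 yields a summand with two inverting involutions of opposite
   parities. *)
From HB Require Import structures.
Require Import Defs.
From mathcomp Require Import all_boot all_order all_algebra.
From mathcomp Require Import ring.
From Stdlib Require Import Classical.

Set Implicit Arguments.
Unset Strict Implicit.
Unset Printing Implicit Defensive.

Import GRing.Theory.
Local Open Scope ring_scope.

(** * Iterates, cyclic subspaces and alternating forms *)

Section LinearAlgebra.
Variables (K : fieldType) (V : vectType K).
Implicit Types (g h : 'End(V)) (U W X : {vspace V}) (x y v w : V).

(** The condition on [Q (N^m v)] comes from [f (N^m v) (N^m v) = (-1)^m f (N^(2m) v) v], so that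
    [2 Q (N^m v)] pairs [v] with the top of its cyclic space. In characteristic other than 2, a
    nonzero value makes this space nondegenerate of odd dimension [2m + 1], where an inverting [s]
    and [- s] differ in parity. In characteristic 2 the pairing vanishes although [Q (N^m v)] need
    not, and this case is the obstacle: [v] needs a partner [w], with two involutions that fix [v]
    and send [w] to [phi w] and to [w + v]. The values of [f _ w] which they demand are consistent
    because [theta = phi + phi^-1] raises the filtration by [N] in steps of two, so the vectors with
    prescribed values have distinct heights.

    A map prescribed on generators must respect all relations between them. These are never
    computed: its graph, generated in [V * V] under [(phi, phi^-1)], is totally singular for
    [Q z.1 - Q z.2], and if it is closed under the swap and projects onto a nondegenerate space, it
    is the graph of an involution. *)

Definition lexp g i : 'End(V) := iter i (comp_lfun g) \1%VF.

Lemma lexpE g i x : lexp g i x = iter i g x.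
Proof. by elim: i => [|i IH] /=; rewrite ?id_lfunE // comp_lfunE -IH. Qed.

Lemma iterD_lin g i x y : iter i g (x + y) = iter i g x + iter i g y.
Proof. by rewrite -!lexpE linearD. Qed.

Lemma iterZ_lin g i a x : iter i g (a *: x) = a *: iter i g x.
Proof. by rewrite -!lexpE linearZ. Qed.

Lemma iter0_lin g i : iter i g 0 = 0.
Proof. by rewrite -lexpE linear0. Qed.

Lemma iterN_lin g i x : iter i g (- x) = - iter i g x.
Proof. by rewrite -!lexpE linearN. Qed.

Lemma iterB_lin g i x y : iter i g (x - y) = iter i g x - iter i g y.
Proof. by rewrite -!lexpE linearB. Qed.

Lemma iter_eq0_leq g i j x : (i <= j)%N -> iter i g x = 0 -> iter j g x = 0.
Proof. by move=> /subnK <- gx; rewrite iterD gx iter0_lin. Qed.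

Lemma iter_comm (f g : V -> V) i x :
  (forall y, f (g y) = g (f y)) -> f (iter i g x) = iter i g (f x).
Proof. by move=> fg; elim: i => //= i IH; rewrite fg IH. Qed.

Lemma iter_comm2 (f g : V -> V) i j x :
  (forall y, f (g y) = g (f y)) -> iter j f (iter i g x) = iter i g (iter j f x).
Proof. by move=> fg; elim: j => //= j ->; rewrite iter_comm. Qed.

Lemma iter_compC (f g : V -> V) i x :
  (forall y, f (g y) = g (f y)) ->
  iter i (f \o g) x = iter i f (iter i g x).
Proof.
move=> fg; elim: i => //= i ->; congr (f _).
by rewrite iter_comm // => y; rewrite fg.
Qed.

Lemma mem_lker_lexp g i x : (x \in lker (lexp g i)) = (iter i g x == 0).
Proof. by rewrite memv_ker lexpE. Qed.

Lemma limg_lexpP g i x :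
  reflect (exists y, x = iter i g y) (x \in limg (lexp g i)).
Proof.
apply: (iffP memv_imgP) => [[y _ ->]|[y ->]]; first by exists y; rewrite lexpE.
by exists y; rewrite ?memvf ?lexpE.
Qed.

(** As long as the chain grows, [\dim (U j.+1)] exceeds [j], so growth ends by step [dim V]. This
    serves both the stable hulls [cycs] and the kernels of iterates. *)
Lemma chain_stationary (U : nat -> {vspace V}) :
  (forall i, (U i <= U i.+1)%VS) ->
  (forall i, U i.+1 = U i -> U i.+2 = U i.+1) ->
  forall j, U (dim V + j)%N = U (dim V).
Proof.
move=> incU stU.
have dimU j : (U j.+1 == U j) || (j < \dim (U j.+1))%N.
  elim: j => [|j /orP[/eqP/stU-> | IH]]; rewrite ?eqxx //.
    have [//|neqU] := eqVneq (U 1%N) (U 0%N).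
    rewrite lt0n dimv_eq0; apply: contraNneq neqU => U1.
    by have := incU 0%N; rewrite U1 subv0 eq_sym.
  have [//|neqU] := eqVneq (U j.+2) (U j.+1).
  rewrite /=; apply: leq_ltn_trans IH _; rewrite ltn_neqAle (dimvS (incU _)) andbT.
  by apply: contraNneq neqU => dU; rewrite eq_sym eqEdim incU dU leqnn.
have stn : U (dim V).+1 = U (dim V).
  have /orP[/eqP-> // | ] := dimU (dim V).
  by move=> lt; have := leq_trans lt (dimvS (subvf _)); rewrite dimvf ltnn.
have step i : U (dim V + i).+1 = U (dim V + i)%N.
  by elim: i => [|i IHi]; rewrite ?addn0 // addnS stU.
by elim=> [|j IH]; rewrite ?addn0 // addnS step.
Qed.

(** The [g]-stable hull of [W]: by [chain_stationary] the iteration is stationary after [dim V]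
    steps. *)
Definition cycs g W := iter (dim V) (fun U => (W + g @: U)%VS) 0%VS.

Section Cycs.
Variables (g : 'End(V)) (W : {vspace V}).
Let st i := iter i (fun U => (W + g @: U)%VS) 0%VS.

Let cycsE : (W + g @: cycs g W)%VS = cycs g W.
Proof.
have inc i : (st i <= st i.+1)%VS.
  by elim: i => [|i IH]; rewrite ?sub0v //= addvS // limgS.
have := @chain_stationary st inc _ 1; rewrite addn1 => E; apply: E.
by move=> i; rewrite /st => E1; rewrite iterS E1.
Qed.

Lemma sub_cycs : (W <= cycs g W)%VS.
Proof. by rewrite -cycsE addvSl. Qed.

Lemma cycs_stable x : x \in cycs g W -> g x \in cycs g W.
Proof. by move=> xC; rewrite -cycsE (subvP (addvSr _ _)) // memv_img. Qed.

Lemma cycs_ind (P : V -> Prop) :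
  P 0 -> (forall x y, P x -> P y -> P (x + y)) ->
  (forall x, x \in W -> P x) -> (forall x, P x -> P (g x)) ->
  forall x, x \in cycs g W -> P x.
Proof.
move=> P0 PD PW Pg; rewrite /cycs; elim: (dim V) => [|i IH] x /=.
  by rewrite memv0 => /eqP->.
by case/memv_addP=> w wW [_ /memv_imgP[u uC ->] ->]; apply: PD; auto.
Qed.

Lemma cycs_min X : (W <= X)%VS -> (forall x, x \in X -> g x \in X) ->
  (cycs g W <= X)%VS.
Proof.
move=> WX gX; apply/subvP; apply: cycs_ind => //; first exact: mem0v.
- by move=> x y; apply: memvD.
- exact/subvP.
Qed.

End Cycs.

Lemma iter_stable g X i x :
  (forall x, x \in X -> g x \in X) -> x \in X -> iter i g x \in X.
Proof. by move=> gX xX; elim: i => //= i; apply: gX. Qed.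

Lemma memv_linep x a : a *: x \in <[x]>%VS.
Proof. by rewrite memvZ // memv_line. Qed.

Definition cyc g v := cycs g <[v]>%VS.

Lemma mem_cyc g v : v \in cyc g v.
Proof. by rewrite (subvP (sub_cycs _ _)) // memv_line. Qed.

Lemma cyc_min g v X : v \in X -> (forall x, x \in X -> g x \in X) ->
  (cyc g v <= X)%VS.
Proof. by move=> vX; apply: cycs_min; rewrite -memvE. Qed.

Lemma cyc_ind g v (P : V -> Prop) :
  P 0 -> (forall x y, P x -> P y -> P (x + y)) ->
  (forall a, P (a *: v)) -> (forall x, P x -> P (g x)) ->
  forall x, x \in cyc g v -> P x.
Proof.
move=> P0 PD Pv Pg; apply: cycs_ind => // x /vlineP[a ->]; exact: Pv.
Qed.

Lemma cyc_rec g v : cyc g v = (<[v]> + cyc g (g v))%VS.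
Proof.
apply/eqP; rewrite eqEsubv; apply/andP; split.
  apply: cyc_min; first by rewrite (subvP (addvSl _ _)) // memv_line.
  move=> x /memv_addP[_ /vlineP[a ->] [y yC ->]].
  rewrite linearD linearZ (subvP (addvSr _ _)) // memvD //.
    by rewrite memvZ ?mem_cyc.
  exact: cycs_stable.
rewrite subv_add -memvE mem_cyc /= cyc_min ?cycs_stable ?mem_cyc //.
exact: cycs_stable.
Qed.

Lemma cyc_recP g v x : x \in cyc g v ->
  exists a y, y \in cyc g (g v) /\ x = a *: v + y.
Proof.
rewrite cyc_rec => /memv_addP[_ /vlineP[a ->] [y yC ->]].
by exists a, y.
Qed.

Lemma cyc_addW g v w :
  cycs g (<[v]> + <[w]>) = (cyc g v + cyc g w)%VS.
Proof.
apply/eqP; rewrite eqEsubv; apply/andP; split.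
  apply: cycs_min.
    by apply: addvS; rewrite -memvE mem_cyc.
  move=> _ /memv_addP[x xC [y yC ->]]; rewrite linearD memv_add //.
    exact: cycs_stable.
  exact: cycs_stable.
have sub := sub_cycs g (<[v]> + <[w]>).
rewrite subv_add !cyc_min //; try by move=> x; exact: cycs_stable.
  by rewrite (subvP sub) // (subvP (addvSr _ _)) // memv_line.
by rewrite (subvP sub) // (subvP (addvSl _ _)) // memv_line.
Qed.

Lemma stable_inv g X : lker g = 0%VS -> (forall x, x \in X -> g x \in X) ->
  forall x, x \in X -> (g^-1)%VF x \in X.
Proof.
move=> /eqP kg gX x.
have /eqP eX : (g @: X == X)%VS.
  rewrite eqEdim limg_dim_eq ?leqnn ?andbT; last by rewrite (eqP kg) capv0.
  by apply/subvP=> _ /memv_imgP[y yX ->]; apply: gX.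
by rewrite -{1}eX => /memv_imgP[y yX ->]; rewrite lker0_lfunK.
Qed.

Lemma ker_iter_dim g x : iter (dim V).+1 g x = 0 -> iter (dim V) g x = 0.
Proof.
have := @chain_stationary (fun i => lker (lexp g i)) _ _ 1; rewrite addn1 => E.
move/eqP; rewrite -mem_lker_lexp => gx; apply/eqP; rewrite -mem_lker_lexp -E //.
  move=> i; apply/subvP=> y; rewrite !mem_lker_lexp => /eqP gy.
  by rewrite iterS gy linear0.
move=> i E1; apply/vspaceP=> y.
have /vspaceP/(_ (g y)) := E1.
by rewrite !mem_lker_lexp -!iterSr.
Qed.

Lemma ker_iter_stab g i x : iter i g x = 0 -> iter (dim V) g x = 0.
Proof.
have [/iter_eq0_leq|ni] := leqP i (dim V); first exact.
rewrite -(subnK (ltnW ni)); elim: (i - _)%N x => //= j IH x.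
rewrite -iterS -addSn addnC iterD => /=.
have {}IH := IH.
move=> E; apply: ker_iter_dim; rewrite iterSr; apply: IH.
by rewrite -iterSr -addSn addnC iterD.
Qed.

Lemma fitting_cap g : (lker (lexp g (dim V)) :&: limg (lexp g (dim V)) = 0)%VS.
Proof.
apply/eqP; rewrite -subv0; apply/subvP=> x.
rewrite memv_cap mem_lker_lexp memv0 => /andP[/eqP gx /limg_lexpP[y xE]].
by apply/eqP; rewrite xE (@ker_iter_stab g (dim V + dim V)) // iterD -xE.
Qed.

Lemma dim_cyc_nilp g v k : iter k.+1 g v = 0 -> iter k g v != 0 ->
  \dim (cyc g v) = k.+1.
Proof.
elim: k v => [|k IH] v gk1 gk.
  have -> : cyc g v = <[v]>%VS.
    apply/eqP; rewrite eqEsubv -memvE mem_cyc andbT cyc_min ?memv_line //.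
    by move=> x /vlineP[a ->]; rewrite linearZ /= [g v]gk1 scaler0 mem0v.
  by rewrite dim_vline gk.
rewrite cyc_rec dimv_disjoint_sum.
  rewrite IH -?iterSr // dim_vline; have [v0|//] := eqVneq v 0.
  by rewrite v0 iter0_lin eqxx in gk.
apply/eqP; rewrite -subv0; apply/subvP=> x.
rewrite memv_cap memv0 => /andP[/vlineP[a ->] aC].
have: iter k.+1 g (a *: v) = 0.
  move: aC; apply: (cyc_ind (P := fun x => iter k.+1 g x = 0)).
  - exact: iter0_lin.
  - by move=> y z y0 z0; rewrite iterD_lin y0 z0 addr0.
  - by move=> b; rewrite iterZ_lin -iterSr gk1 scaler0.
  - by move=> y y0; rewrite -iterSr iterS y0 linear0.
rewrite iterZ_lin => /eqP; rewrite scaler_eq0 (negPf gk) orbF => /eqP->.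
by rewrite scale0r.
Qed.

Definition lmap (W : vectType K) (F : V -> W) (linF : linear F) : 'Hom(V, W) :=
  linfun (HB.pack_for {linear V -> W} F (GRing.isLinear.Build K V W *:%R F linF)).

Lemma lmapE (W : vectType K) (F : V -> W) (linF : linear F) x :
  lmap linF x = F x.
Proof. by rewrite lfunE. Qed.

Definition bilinear_form (B : V -> V -> K) : Prop :=
  (forall x, linear (B x : V -> K^o)) /\ (forall y, linear (B^~ y : V -> K^o)).

Section Bilinear.
Variables (B : V -> V -> K) (bilB : bilinear_form B).

Definition blinr x := lmap (bilB.1 x).
Definition blinl y := lmap (bilB.2 y).

Lemma blinrE x y : B x y = blinr x y. Proof. by rewrite lmapE. Qed.
Lemma blinlE x y : B x y = blinl y x. Proof. by rewrite lmapE. Qed.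
Lemma bil0r x : B x 0 = 0. Proof. by rewrite blinrE linear0. Qed.
Lemma bil0l x : B 0 x = 0. Proof. by rewrite blinlE linear0. Qed.
Lemma bilDr x y z : B x (y + z) = B x y + B x z.
Proof. by rewrite !(blinrE x) linearD. Qed.
Lemma bilDl x y z : B (x + y) z = B x z + B y z.
Proof. by rewrite !(blinlE _ z) linearD. Qed.
Lemma bilZr x a y : B x (a *: y) = a * B x y.
Proof. by rewrite !(blinrE x) linearZ. Qed.
Lemma bilZl x a y : B (a *: x) y = a * B x y.
Proof. by rewrite !(blinlE _ y) linearZ. Qed.

(** A pair with [B x y = 1] spans a hyperbolic plane, and its complement [U'] in [U] has the same
    radical; splitting off planes leaves the radical. Alternation is asked for on [U] only, since
    the forms below need not be alternating elsewhere. *)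
Lemma alternating_even U R :
  (forall x, x \in U -> B x x = 0) -> (R <= U)%VS ->
  (forall x, x \in U -> (x \in R) <-> (forall y, y \in U -> B x y = 0)) ->
  odd (\dim U) = odd (\dim R).
Proof.
have [n] := ubnP (\dim U); elim: n U => // n IH U leU alt RU rad.
have skew x y : x \in U -> y \in U -> B y x = - B x y.
  move=> xU yU; apply/eqP; rewrite -addr_eq0 addrC.
  by have := alt _ (memvD xU yU); rewrite bilDr !bilDl !alt // add0r addr0 addrC => ->.
have [UR|] := boolP (U <= R)%VS.
  by have /eqP-> : U == R by rewrite eqEsubv UR RU.
case/subvPn=> x xU xR.
have [y yU Bxy] : exists2 y, y \in U & B x y = 1.
  have [UB|] := boolP (U <= lker (blinr x))%VS.
    case/negP: xR; apply/rad => // y /(subvP UB).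
    by rewrite memv_ker -blinrE => /eqP.
  case/subvPn=> y yU; rewrite memv_ker -blinrE => nz.
  by exists ((B x y)^-1 *: y); rewrite ?memvZ // bilZr mulVf.
pose U' := (U :&: (lker (blinr x) :&: lker (blinr y)))%VS.
have U'P z : (z \in U') = [&& z \in U, B x z == 0 & B y z == 0].
  by rewrite !memv_cap !memv_ker -!blinrE.
have U'U : (U' <= U)%VS by apply: capvSl.
have decU z : z \in U -> z - B x z *: y + B y z *: x \in U'.
  move=> zU; rewrite U'P memvD ?memvB ?memvZ //=.
  rewrite -scaleNr !bilDr !bilZr !alt // (skew x y) // Bxy.
  by rewrite mulr0 addr0 mulr1 mulrN1 subrr mulr0 addr0 subrr eqxx.
have Udec : U = (U' + (<[x]> + <[y]>))%VS.
  apply/eqP; rewrite eqEsubv subv_add U'U subv_add -!memvE xU yU !andbT.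
  apply/subvP=> z zU; have -> : z = (z - B x z *: y + B y z *: x)
      + (- B y z *: x + B x z *: y).
    by rewrite scaleNr addrA addrK subrK.
  by rewrite memv_add ?decU // memv_add // memv_linep.
have cap0 : (U' :&: (<[x]> + <[y]>) = 0)%VS.
  apply/eqP; rewrite -subv0; apply/subvP=> z; rewrite memv_cap U'P memv0.
  case/andP=> /and3P[_ xz yz] /memv_addP[_ /vlineP[a ->] [_ /vlineP[b ->] zE]].
  move: xz yz; rewrite zE !bilDr !bilZr !alt // (skew x y) // Bxy.
  rewrite !mulr0 add0r mulr1 addr0 mulrN1 oppr_eq0 => /eqP-> /eqP->.
  by rewrite !scale0r addr0.
have dim2 : \dim (<[x]> + <[y]>) = 2%N.
  have nz u v : B u v = 1 -> u != 0 /\ v != 0.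
    move=> E; split; apply/eqP=> Z; move: E; rewrite Z ?bil0l ?bil0r.
      by move/eqP; rewrite eq_sym oner_eq0.
    by move/eqP; rewrite eq_sym oner_eq0.
  have [x0 y0] := nz _ _ Bxy.
  rewrite dimv_disjoint_sum ?dim_vline ?x0 ?y0 //.
  apply/eqP; rewrite -subv0; apply/subvP=> z; rewrite memv_cap memv0.
  case/andP=> /vlineP[a ->] /vlineP[b E].
  have := congr1 (B x) E; rewrite !bilZr alt // mulr0 Bxy mulr1 => b0.
  by rewrite E -b0 scale0r.
have dU : \dim U = (\dim U').+2 by rewrite {1}Udec dimv_disjoint_sum // dim2 addn2.
rewrite dU /= negbK; apply: IH; first by move: leU; rewrite dU !ltnS => /ltnW.
- by move=> z /(subvP U'U); apply: alt.
- apply/subvP=> z zR; have zU := subvP RU z zR.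
  have Bz := (rad z zU).1 zR.
  by rewrite U'P zU (skew z x) // (skew z y) // !Bz // oppr0 eqxx.
move=> z zU'; have zU := subvP U'U z zU'.
split=> [/(rad z zU).1 Bz w /(subvP U'U)|Bz]; first exact: Bz.
apply/rad => // w; rewrite {1}Udec.
case/memv_addP=> w' w'U [_ /memv_addP[_ /vlineP[a ->] [_ /vlineP[b ->] ->]] ->].
rewrite U'P in zU'; case/and3P: zU' => _ /eqP xz /eqP yz.
rewrite !bilDr !bilZr Bz // (skew x z) // (skew y z) // xz yz.
by rewrite oppr0 !mulr0 !addr0.
Qed.

End Bilinear.

End LinearAlgebra.

Lemma img_cycs (K : fieldType) (V W : vectType K) (h : 'Hom(V, W))
    (g : 'End(V)) (g' : 'End(W)) (U : {vspace V}) :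
  (forall y, h (g y) = g' (h y)) -> (h @: cycs g U)%VS = cycs g' (h @: U).
Proof.
move=> hg; apply/eqP; rewrite eqEsubv; apply/andP; split; last first.
  apply: cycs_min; first by rewrite limgS ?sub_cycs.
  by move=> _ /memv_imgP[x xC ->]; rewrite -hg memv_img // cycs_stable.
apply/subvP=> _ /memv_imgP[x xC ->]; move: x xC.
apply: cycs_ind => [|x y xC yC|x xU|x xC]; rewrite ?linear0 ?mem0v //.
- by rewrite linearD memvD.
- by rewrite (subvP (sub_cycs _ _)) ?memv_img.
- by rewrite hg cycs_stable.
Qed.

Lemma img_cyc (K : fieldType) (V W : vectType K) (h : 'Hom(V, W))
    (g : 'End(V)) (g' : 'End(W)) v :
  (forall y, h (g y) = g' (h y)) -> (h @: cyc g v)%VS = cyc g' (h v).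
Proof. by move=> hg; rewrite /cyc (img_cycs _ hg) limg_line. Qed.

(** * Orthogonality and the parity of isometries *)

Section Quadratic.
Variables (K : fieldType) (V : vectType K) (Q : V -> K).
Hypothesis quadQ : quadratic_form Q.
Local Notation f := (polar Q).
Implicit Types (x y z v w : V) (g a b c : 'End(V)) (U W H L : {vspace V}).

Lemma polar_bilinear : bilinear_form f.
Proof. by split=> [x|y]; [apply: quadQ.2.2 | apply: quadQ.2.1]. Qed.
Let bilf := polar_bilinear.

Lemma polarC x y : f x y = f y x.
Proof. by rewrite /polar [y + x]addrC addrAC. Qed.

Lemma quadZ k v : Q (k *: v) = k ^+ 2 * Q v.
Proof. exact: quadQ.1. Qed.

Lemma quad0 : Q 0 = 0.
Proof. by rewrite -(scale0r (0 : V)) quadZ expr0n mul0r. Qed.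

Lemma quadN v : Q (- v) = Q v.
Proof. by rewrite -scaleN1r quadZ sqrrN expr1n mul1r. Qed.

Lemma quadD x y : Q (x + y) = Q x + Q y + f x y.
Proof. by rewrite /polar; ring. Qed.

Lemma polarxx x : f x x = Q x *+ 2.
Proof.
by rewrite /polar -mulr2n -scaler_nat quadZ; ring.
Qed.

Lemma polarDr x y z : f x (y + z) = f x y + f x z.
Proof. exact: (bilDr bilf). Qed.
Lemma polarDl x y z : f (x + y) z = f x z + f y z.
Proof. exact: (bilDl bilf). Qed.
Lemma polarZr x k y : f x (k *: y) = k * f x y.
Proof. exact: (bilZr bilf). Qed.
Lemma polarZl x k y : f (k *: x) y = k * f x y.
Proof. exact: (bilZl bilf). Qed.
Lemma polarNr x y : f x (- y) = - f x y.
Proof. by rewrite -scaleN1r polarZr mulN1r. Qed.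
Lemma polarNl x y : f (- x) y = - f x y.
Proof. by rewrite polarC polarNr polarC. Qed.
Lemma polarBr x y z : f x (y - z) = f x y - f x z.
Proof. by rewrite polarDr polarNr. Qed.
Lemma polarBl x y z : f (x - y) z = f x z - f y z.
Proof. by rewrite polarDl polarNl. Qed.
Lemma polar0r x : f x 0 = 0. Proof. exact: (bil0r bilf). Qed.
Lemma polar0l x : f 0 x = 0. Proof. exact: (bil0l bilf). Qed.

Lemma quadB x y : Q (x - y) = Q x + Q y - f x y.
Proof. by rewrite quadD quadN polarNr. Qed.

Lemma polar_sumr (I : finType) x (F : I -> V) :
  f x (\sum_i F i) = \sum_i f x (F i).
Proof. by rewrite (blinrE bilf) linear_sum; apply: eq_bigr => i _; rewrite (blinrE bilf). Qed.

Lemma polar_suml (I : finType) x (F : I -> V) :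
  f (\sum_i F i) x = \sum_i f (F i) x.
Proof. by rewrite polarC polar_sumr; apply: eq_bigr => i _; rewrite polarC. Qed.

Definition perp U : {vspace V} :=
  (\bigcap_(i < \dim U) lker (blinr bilf (vbasis U)`_i))%VS.

Lemma perpP U x : reflect (forall u, u \in U -> f u x = 0) (x \in perp U).
Proof.
apply: (iffP idP) => [xp u uU|xp].
  rewrite (coord_vbasis uU) polar_suml big1 // => i _; rewrite polarZl.
  move: xp; rewrite memvE => /subv_bigcapP/(_ i isT).
  by rewrite -memvE memv_ker -blinrE polarC => /eqP->; rewrite mulr0.
rewrite memvE; apply/subv_bigcapP => i _; rewrite -memvE memv_ker -blinrE.
by rewrite xp // vbasis_mem // mem_nth // size_tuple.
Qed.

Lemma perpPr U x : reflect (forall u, u \in U -> f x u = 0) (x \in perp U).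
Proof.
by apply: (iffP (perpP U x)) => E u uU; [rewrite polarC|rewrite polarC]; apply: E.
Qed.

Lemma leq_dim_perp U W : (\dim W <= \dim (W :&: perp U) + \dim U)%N.
Proof.
pose F x : 'rV[K]_(\dim U) := \row_i f (vbasis U)`_i x.
have linF : linear F.
  by move=> k x y; apply/rowP=> i; rewrite !mxE polarDr polarZr.
have -> : (W :&: perp U)%VS = (W :&: lker (lmap linF))%VS.
  apply/vspaceP=> x; rewrite !memv_cap; congr (_ && _).
  rewrite memv_ker lmapE; apply/idP/eqP => [/perpP xp|E].
    by apply/rowP=> i; rewrite !mxE xp // vbasis_mem // mem_nth // size_tuple.
  rewrite memvE; apply/subv_bigcapP => i _; rewrite -memvE memv_ker -blinrE.
  by have /rowP/(_ i) := E; rewrite !mxE => ->.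
rewrite -(limg_ker_dim (lmap linF) W) leq_add2l.
by have := dimvS (subvf (lmap linF @: W)); rewrite dimvf dim_matrix mul1r.
Qed.

Lemma perpS U W : (U <= W)%VS -> (perp W <= perp U)%VS.
Proof. by move=> /subvP UW; apply/subvP=> x /perpP xW; apply/perpP; auto. Qed.

Lemma perpD U W : perp (U + W) = (perp U :&: perp W)%VS.
Proof.
apply/eqP; rewrite eqEsubv subv_cap !perpS ?addvSl ?addvSr //=.
apply/subvP=> x; rewrite memv_cap => /andP[/perpP xU /perpP xW].
apply/perpP=> _ /memv_addP[u uU [w wW ->]].
by rewrite polarDl xU ?xW // addr0.
Qed.

Definition isometry_of g := forall v, Q (g v) = Q v.

Lemma isomP g : isometry_of g -> forall x y, f (g x) (g y) = f x y.
Proof. by move=> ig x y; rewrite /polar -linearD !ig. Qed.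

Lemma isom_comp a b : isometry_of a -> isometry_of b -> isometry_of (a \o b)%VF.
Proof. by move=> ia ib x; rewrite comp_lfunE ia. Qed.

Lemma isom_opp g : isometry_of g -> isometry_of (- g).
Proof. by move=> ig x; rewrite opp_lfunE quadN. Qed.

Section Nondegenerate.
Hypothesis ndefQ : nondefective Q.

Lemma perp_full : perp fullv = 0%VS.
Proof.
apply/eqP; rewrite -subv0; apply/subvP=> x /perpPr xp.
by rewrite memv0; apply/eqP/ndefQ => w; rewrite xp ?memvf.
Qed.

Lemma dim_perp U : (\dim (perp U) + \dim U)%N = dim V.
Proof.
apply/eqP; rewrite eqn_leq; apply/andP; split; last first.
  by have := leq_dim_perp U fullv; rewrite capfv dimvf.
(* A vector of [U] orthogonal to a complement of [perp U] is orthogonal to [V], hence zero, so this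
   complement has at least the dimension of [U]. *)
have := leq_dim_perp (perp U)^C U.
suff -> : (U :&: perp (perp U)^C = 0)%VS.
  by rewrite dimv0 add0n dimv_compl dimvf leq_subRL // -dimvf dimvS ?subvf.
apply/eqP; rewrite -subv0 -perp_full -(addv_complf (perp U)) perpD.
apply/subvP=> x; rewrite !memv_cap => /andP[xU ->]; rewrite andbT.
by apply/perpP=> u /perpPr/(_ x xU).
Qed.

Lemma perpK U : perp (perp U) = U.
Proof.
apply/esym/eqP; rewrite eqEdim; apply/andP; split.
  by apply/subvP=> x xU; apply/perpP=> u /perpPr/(_ x xU).
by rewrite -(leq_add2l (\dim (perp U))) dim_perp addnC dim_perp.
Qed.

Lemma perp_cap U W : perp (U :&: W) = (perp U + perp W)%VS.
Proof. by rewrite -[RHS]perpK perpD !perpK. Qed.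

Lemma exists_perp_notin U x : x \notin U ->
  exists2 w, w \in perp U & f x w != 0.
Proof.
move=> xU; have [/eqP|] := boolP (perp U <= perp <[x]>)%VS.
  move=> /eqP/perpS; rewrite !perpK => /subvP/(_ x (memv_line x)) xU'.
  by rewrite xU' in xU.
case/subvPn=> w wU wx; exists w => //; apply: contra wx => /eqP fx.
by apply/perpP=> _ /vlineP[k ->]; rewrite polarZl fx mulr0.
Qed.

Lemma isom_ker g : isometry_of g -> lker g = 0%VS.
Proof.
move=> ig; apply/eqP; rewrite -subv0; apply/subvP=> x.
rewrite memv_ker memv0 => /eqP gx; apply/eqP/ndefQ => w.
by rewrite -(isomP ig) gx polar0l.
Qed.

Lemma isom_orthogonal g : isometry_of g -> orthogonal_group Q g.
Proof. by move=> ig; split=> //; apply: isom_ker. Qed.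

Lemma isomVK g : isometry_of g -> cancel (g^-1)%VF g.
Proof. by move=> /isom_ker/eqP; apply: lker0_lfunVK. Qed.

Lemma isomKV g : isometry_of g -> cancel g (g^-1)%VF.
Proof. by move=> /isom_ker/eqP; apply: lker0_lfunK. Qed.

Lemma isom_inv g : isometry_of g -> isometry_of (g^-1)%VF.
Proof. by move=> ig x; rewrite -[RHS](congr1 Q (isomVK ig x)) ig. Qed.

Lemma isom_adj g x y : isometry_of g -> f (g x) y = f x (g^-1%VF y).
Proof. by move=> ig; rewrite -{1}(isomVK ig y) isomP. Qed.

Lemma isom_adjV g x y : isometry_of g -> f ((g^-1)%VF x) y = f x (g y).
Proof. by move=> ig; rewrite polarC -isom_adj // polarC. Qed.

Lemma perp_limg_sub1 g : isometry_of g ->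
  perp (limg (g - \1%VF)) = lker (g - \1%VF).
Proof.
move=> ig; apply/vspaceP=> x; apply/perpPr/idP=> [xp|].
  rewrite memv_ker add_lfunE opp_lfunE id_lfunE.
  have: (g^-1)%VF x - x = 0.
    apply: ndefQ => w; rewrite polarBl isom_adjV // -polarBr.
    by have := xp _ (memv_img (g - \1%VF) (memvf w));
      rewrite add_lfunE opp_lfunE id_lfunE.
  by move/subr0_eq => E; rewrite -{1}E isomVK // subrr.
move=> /eqlfunP; rewrite id_lfunE => gx _ /memv_imgP[u _ ->].
by rewrite add_lfunE opp_lfunE id_lfunE polarBr -{1}gx isomP // subrr.
Qed.

Lemma dim_ker_limg g : (\dim (lker g) + \dim (limg g))%N = dim V.
Proof. by rewrite -(capfv (lker g)) limg_ker_dim dimvf. Qed.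

(* [(a - 1) v = (b - 1) w] where [w] is picked linearly; then
   [f (v - w) (a - 1) v = - Q ((a - 1) v) + Q ((b - 1) w) = 0], so the form
   below is alternating and the dimension of its radical gives the parity. *)
Lemma parity_triangle a b : isometry_of a -> isometry_of b ->
  odd (\dim (limg (a - b))) =
  odd (\dim (limg (a - \1%VF))) (+) odd (\dim (limg (b - \1%VF))).
Proof.
move=> ia ib.
set A := a - \1%VF; set B := b - \1%VF.
pose U1 := (A @^-1: (limg B))%VS; pose s := (B^-1)%VF.
have U1P v : v \in U1 -> B (s (A v)) = A v.
  by rewrite -memv_preim => Av; rewrite limg_lfunVK.
pose F v v' := f (v - s (A v)) (A v').
have bilF : bilinear_form F.
  split=> [x k y z | y k x z]; rewrite /F.
    by rewrite linearP polarDr polarZr.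
  rewrite -[RHS]/(k * _ + _) -polarZl -polarDl // [A _]linearP [s _]linearP.
  by rewrite opprD addrACA scalerBr.
have formA g x : isometry_of g -> f x ((g - \1%VF) x) = - Q ((g - \1%VF) x).
  move=> ig; rewrite add_lfunE opp_lfunE id_lfunE quadB ig polarBr polarxx.
  by rewrite polarC opprB mulr2n.
pose K1 := lker A; pose K2 := lker B; pose K12 := lker (a - b).
have K12A v : v \in K12 -> A v = B v.
  by move/eqlfunP=> E; rewrite !add_lfunE E.
have K1U : (K1 <= U1)%VS by rewrite /K1 -lpreim0 lpreimS ?sub0v.
have KU : (K1 + K12 <= U1)%VS.
  rewrite subv_add K1U; apply/subvP=> v /K12A Ev.
  by rewrite -memv_preim Ev memv_img ?memvf.
have capK : (K1 :&: K12 = K1 :&: K2)%VS.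
  apply/vspaceP=> v; rewrite !memv_cap; apply: andb_id2l.
  rewrite !memv_ker !add_lfunE !opp_lfunE id_lfunE.
  by rewrite subr_eq0 => /eqP->; rewrite -oppr_eq0 opprB.
have altF v : v \in U1 -> F v v = 0.
  move=> vU; have := formA b (s (A v)) ib; rewrite -/B U1P // => E.
  by rewrite /F polarBl E formA // subrr.
(* For [y] in [U1] the vector [A y] runs over [limg A :&: limg B], whose orthogonal is
   [lker A + lker B]. If [v - s (A v) = k1 + k2] in this sum, then [A] and [B] agree on [v - k1]. *)
have radF v : v \in U1 -> (v \in K1 + K12)%VS <-> (forall y, y \in U1 -> F v y = 0).
  move=> vU; split.
    case/memv_addP=> k1 k1K [k2 k2K vE] y yU.
    have Ak1 : A k1 = 0 by apply/eqP; rewrite -memv_ker.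
    suff: v - s (A v) \in perp (limg A :&: limg B).
      by move/perpPr; apply; rewrite memv_cap memv_img ?memvf //= -U1P // memv_img ?memvf.
    rewrite perp_cap !perp_limg_sub1 // vE.
    have -> : k1 + k2 - s (A (k1 + k2)) = k1 + (k2 - s (A (k1 + k2))) by rewrite addrA.
    rewrite memv_add // memv_ker [B _]linearB /= -vE U1P // vE [A _]linearD /= Ak1 add0r.
    by rewrite K12A // subrr.
  move=> Fv; have: v - s (A v) \in perp (limg A :&: limg B).
    apply/perpPr=> _ /memv_capP[/memv_imgP[y _ ->] yB].
    by apply: Fv; rewrite -memv_preim.
  rewrite perp_cap !perp_limg_sub1 // => /memv_addP[k1 k1K [k2 k2K E]].
  have Ak1 : A k1 = 0 by apply/eqP; rewrite -memv_ker.
  have Bk2 : B k2 = 0 by apply/eqP; rewrite -memv_ker.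
  have -> : v = k1 + (v - k1) by rewrite addrC subrK.
  rewrite memv_add //; apply/eqlfunP/(@addIr _ (- (v - k1))).
  have -> : a (v - k1) - (v - k1) = A (v - k1).
    by rewrite add_lfunE opp_lfunE id_lfunE.
  have -> : b (v - k1) - (v - k1) = B (v - k1).
    by rewrite add_lfunE opp_lfunE id_lfunE.
  rewrite [A _]linearB /= Ak1 subr0.
  have -> : v - k1 = s (A v) + k2.
    by apply/eqP; rewrite subr_eq -addrA [k2 + k1]addrC -E addrC subrK.
  by rewrite [B _]linearD /= Bk2 addr0 U1P.
have := alternating_even bilF altF KU radF.
have dU1 : \dim U1 = (\dim K1 + \dim (limg A :&: limg B))%N.
  have imU : (A @: U1 = limg A :&: limg B)%VS.
    by rewrite /U1 -lpreim_cap_limg capvC lpreimK ?capvSl.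
  by rewrite -(limg_ker_dim A) imU; congr (\dim _ + _)%N; apply/capv_idPr.
(* Rank-nullity, inclusion-exclusion and orthogonality tie all these dimensions together; modulo 2 a
   finite Boolean check remains. *)
have dA := dim_ker_limg A; have dB := dim_ker_limg B.
have dab := dim_ker_limg (a - b).
have dK := dimv_sum_cap K1 K12; rewrite capK in dK.
have dI := dimv_sum_cap (limg A) (limg B).
have dP := dim_perp (limg A + limg B); rewrite perpD !perp_limg_sub1 // in dP.
rewrite dU1; move: dA dB dab dK dI dP; rewrite -/K1 -/K2 -/K12.
move/(congr1 odd) => dA /(congr1 odd) dB /(congr1 odd) dab /(congr1 odd) dK.
move=> /(congr1 odd) dI /(congr1 odd) dP; move: dA dB dab dK dI dP.
rewrite !oddD; case: (odd (\dim (limg (a - b)))); case: (odd (\dim (limg A)));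
  case: (odd (\dim (limg B))); case: (odd (dim V)); case: (odd (\dim K1));
  case: (odd (\dim K2)); case: (odd (\dim K12));
  case: (odd (\dim (K1 :&: K2))); case: (odd (\dim (limg A + limg B)));
  case: (odd (\dim (limg A :&: limg B))); case: (odd (\dim (K1 + K12))) => //.
Qed.

(* The form [f v ((c - 1) v')] is alternating on [(c - 1)^-1 L], with radical
   [L + ker (c - 1)]. *)
Lemma lagrangian_even c L : isometry_of c -> perp L = L ->
  (forall x, x \in L -> Q x = 0) -> (forall x, x \in L -> c x \in L) ->
  ~~ odd (\dim (limg (c - \1%VF))).
Proof.
move=> ic pL QL cL; set C := c - \1%VF.
pose U := (C @^-1: L)%VS; pose F v v' := f v (C v').
have bilF : bilinear_form F.
  split=> [x k y z | y k x z]; rewrite /F.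
    by rewrite linearP polarDr polarZr.
  by rewrite polarDl polarZl.
have CL x : x \in L -> C x \in L.
  by move=> xL; rewrite add_lfunE opp_lfunE id_lfunE memvB ?cL.
have KU : (L + lker C <= U)%VS.
  rewrite subv_add; apply/andP; split.
    by apply/subvP=> x xL; rewrite -memv_preim CL.
  by rewrite -lpreim0 lpreimS ?sub0v.
have altF x : x \in U -> F x x = 0.
  rewrite -memv_preim => /QL; rewrite /F /C add_lfunE opp_lfunE id_lfunE.
  rewrite quadB ic polarBr polarxx polarC => /eqP; rewrite -mulr2n.
  by rewrite subr_eq0 => /eqP->; rewrite subrr.
have imU : (C @: U = L :&: limg C)%VS.
  by rewrite /U -lpreim_cap_limg lpreimK ?capvSr.
have pLC : perp (L :&: limg C) = (L + lker C)%VS.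
  by rewrite perp_cap pL perp_limg_sub1.
have radF x : x \in U ->
    (x \in L + lker C)%VS <-> (forall y, y \in U -> F x y = 0).
  move=> xU; rewrite -pLC; split=> [/perpPr xp y yU|xp].
    by rewrite /F xp // -imU memv_img.
  by apply/perpPr=> z; rewrite -imU => /memv_imgP[y yU ->]; apply: xp.
have := alternating_even bilF altF KU radF.
have := limg_ker_dim C U; rewrite imU.
have -> : (U :&: lker C = lker C)%VS.
  by apply/capv_idPr; rewrite -lpreim0 lpreimS ?sub0v.
have dC := dim_ker_limg C; have dL := dim_perp L; rewrite pL in dL.
have dp := dim_perp (L :&: limg C); rewrite pLC in dp.
have dI := dimv_sum_cap L (lker C).
move=> /(congr1 odd) dU.
move: (congr1 odd dC) (congr1 odd dL) (congr1 odd dp) (congr1 odd dI) dU.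
rewrite !oddD.
case: (odd (\dim (limg C))); case: (odd (\dim L)); case: (odd (\dim (lker C)));
case: (odd (dim V)); case: (odd (\dim (L + lker C))); case: (odd (\dim U));
case: (odd (\dim (L :&: limg C))); case: (odd (\dim (L :&: lker C))) => //.
Qed.

End Nondegenerate.
End Quadratic.

(** * Isometries of bilinear forms in odd dimension *)

Section OddIsometry.
Variables (K : fieldType) (n : nat) (F X : 'M[K]_n).
Hypotheses (oddn : odd n) (unitX : X \in unitmx) (isoF : F *m X *m F^T = X).

Let d := \det F.

Lemma bilinear_isometry_det : d ^+ 2 = 1.
Proof.
have := congr1 determinant isoF; rewrite !det_mulmx det_tr -/d mulrAC -expr2.
move/(canRL (mulrK _)); rewrite divrr; [apply|]; by rewrite -unitmxE.
Qed.

(** Rational functions give a meaning to [p(1/x)], and there the determinants of [X] and of its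
    image can be cancelled. *)
Let E := {fraction {poly K}}.
Let iota : {rmorphism K -> E} := (@tofrac {poly K} \o polyC : {rmorphism K -> E}).
Let x : E := @tofrac {poly K} 'X.

Let x_neq0 : x != 0.
Proof. by rewrite tofrac_eq0 polyX_eq0. Qed.

Let p := char_poly F.

(* The relation [d p(x) = - x^n p(1/x)] between coefficients. *)
Lemma isometry_char_poly_coef j : (j <= n)%N -> d * p`_j + p`_(n - j) = 0.
Proof.
move=> lejn.
pose A := map_mx iota F; pose Y := map_mx iota X.
have isoA : A *m Y *m A^T = Y by rewrite /A /Y map_trmx -!map_mxM isoF.
have detY : \det Y != 0.
  rewrite det_map_mx fmorph_eq0 -unitfE -unitmxE; exact: unitX.
have detA : \det A = iota d by rewrite det_map_mx.
have evalp (y : E) : (map_poly iota p).[y] = \det (y%:M - A).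
  rewrite /p map_char_poly -/A -horner_evalE -det_map_mx; congr (\det _).
  by apply/matrixP=> i k; rewrite !mxE /= /horner_eval !hornerE hornerMn hornerX.
have key : (map_poly iota p).[x] * iota d = - x ^+ n * (map_poly iota p).[x^-1].
  rewrite !evalp -detA.
  have E1 : (x%:M - A) *m (Y *m A^T) = Y *m (- x *: (x^-1%:M - A))^T.
    have -> : (- x *: (x^-1%:M - A))^T = x *: A^T - 1%:M.
      rewrite linearZ /= linearB /= tr_scalar_mx scalerBr scale_scalar_mx.
      by rewrite mulNr divff ?x_neq0 // scaleNr opprK raddfN /= addrC.
    by rewrite mulmxBl mul_scalar_mx mulmxA isoA mulmxBr mulmx1 -scalemxAr.
  have := congr1 determinant E1.
  rewrite !det_mulmx !det_tr detZ mulrCA => /(mulfI detY) ->.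
  by rewrite exprNn -signr_odd oddn expr1 mulN1r.
have hornE (y : E) : (map_poly iota p).[y] = \sum_(i < n.+1) iota p`_i * y ^+ i.
  rewrite (@horner_coef_wide _ n.+1) ?size_map_poly ?size_char_poly //.
  by apply: eq_bigr => i _; rewrite coef_map.
have polyE : \sum_(i < n.+1) (d * p`_i + p`_(n - i)) *: 'X^i = 0 :> {poly K}.
  have E2 : x ^+ n * (map_poly iota p).[x^-1] =
      \sum_(i < n.+1) iota p`_(n - i) * x ^+ i.
    rewrite hornE mulr_sumr (reindex_inj rev_ord_inj) /=; apply: eq_bigr => i _.
    rewrite subSS mulrCA exprVn; congr (_ * _).
    by rewrite -{1}(subnK (leq_ord i)) exprD mulrAC divff ?mul1r ?expf_neq0.
  apply/eqP; rewrite -tofrac_eq0; apply/eqP; rewrite rmorph_sum /=.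
  have /eqP := key; rewrite mulNr -subr_eq0 opprK E2 hornE mulr_suml -big_split /=.
  move/eqP => E3; rewrite -[RHS]E3; apply: eq_bigr => i _; rewrite -mul_polyC rmorphM rmorphXn /=.
  by rewrite polyCD polyCM rmorphD rmorphM mulrDl /=; congr (_ + _); rewrite mulrC mulrA mulrAC [_ * x ^+ _]mulrC -mulrA. 
have := congr1 (coefp j) polyE; rewrite /= coef_sum coef0.
rewrite (bigD1 (Ordinal (lejn : j < n.+1)%N)) //= coefZ coefXn eqxx mulr1.
rewrite big1 ?addr0 // => i neq; rewrite coefZ coefXn.
by case: eqP => [ji|]; rewrite ?mulr0 //; case/eqP: neq; apply: val_inj.
Qed.

(** Evaluating the relation at [d] only gives [p(d) = - p(d)], which is empty in characteristic 2.
    Instead the terms of index [i] and [n - i] cancel, as [d^2 = 1], and [n] being odd they form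
    disjoint pairs. *)
Lemma odd_isometry_eigenvalue : root p d.
Proof.
have d2 := bilinear_isometry_det.
rewrite rootE (@horner_coef_wide _ n.+1) ?size_char_poly //.
pose g i := p`_i * d ^+ i.
have gN i : (i <= n)%N -> g (n - i)%N = - g i.
  move=> lein; rewrite /g.
  have -> : p`_(n - i) = - (d * p`_i).
    by apply/eqP; rewrite -addr_eq0 addrC isometry_char_poly_coef.
  have dpar m : d ^+ m = d ^+ odd m.
    by rewrite -{1}(odd_double_half m) exprD -mul2n exprM d2 expr1n mulr1.
  rewrite mulNr [d * _]mulrC -mulrA -exprS; congr (- (_ * _)).
  by rewrite (dpar (n - i).+1) (dpar i) oddS oddB // oddn addTb negbK.
have n1E : n.+1 = ((uphalf n) + (uphalf n))%N.
  by rewrite addnn -[LHS](odd_double_half n.+1) /= oddn.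
rewrite -(big_mkord xpredT g) n1E big_mkord.
rewrite big_split_ord /= [X in _ + X](reindex_inj rev_ord_inj) /= -big_split /=.
apply/eqP/big1 => i _.
have lt_n : (i <= n)%N.
  by rewrite -ltnS n1E (leq_trans (ltn_ord i)) ?leq_addr.
have -> : (uphalf n + (uphalf n - i.+1) = n - i)%N.
  by rewrite addnBA ?(ltn_ord i) // -n1E subSS.
by rewrite gN // subrr.
Qed.

End OddIsometry.

(** * The parity of the centralizer *)

Section Centralizer.
Variables (K : fieldType) (V : vectType K) (Q : V -> K).
Hypotheses (quadQ : quadratic_form Q) (ndefQ : nondefective Q).
Local Notation f := (polar Q).
Implicit Types (x y z v w : V) (g a b c phi : 'End(V)) (U W H L : {vspace V}).

Lemma sub1E g x : (g - \1%VF) x = g x - x.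
Proof. by rewrite add_lfunE opp_lfunE id_lfunE. Qed.

(* [c - 1] carries the form [f v z] on [V] to a nondegenerate bilinear form on
   [M = im (c - 1)], the Wall form of [c]; it is invariant under [phi]. *)
Lemma nofix_centralizer_even phi c : isometry_of Q phi -> isometry_of Q c ->
  (forall x, c (phi x) = phi (c x)) ->
  (forall x, phi x = x -> x = 0) -> (forall x, phi x = - x -> x = 0) ->
  ~~ odd (\dim (limg (c - \1%VF))).
Proof.
move=> iphi ic cphi fix1 fixN1; apply/negP=> oddM.
set C := c - \1%VF in oddM; set M := limg C in oddM.
pose e := vbasis M; pose s := (C^-1)%VF.
have sK z : z \in M -> C (s z) = z by apply: limg_lfunVK.
have phiC x : phi (C x) = C (phi x) by rewrite !sub1E linearB cphi.
have eM i : e`_i \in M.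
  have [lti|gei] := ltnP i (\dim M).
    by rewrite vbasis_mem // mem_nth // size_tuple.
  by rewrite nth_default ?mem0v // size_tuple.
have phiM z : z \in M -> phi z \in M.
  by case/memv_imgP=> v _ ->; rewrite phiC memv_img ?memvf.
have kerM v z : C v = 0 -> z \in M -> f v z = 0.
  move=> Cv zM; have: v \in perp quadQ M.
    by rewrite perp_limg_sub1 // memv_ker -/C Cv.
  by move/perpPr; apply.
have eqM v v' z : C v = C v' -> z \in M -> f v z = f v' z.
  move=> E zM; apply/eqP; rewrite -subr_eq0 -(polarBl quadQ); apply/eqP/kerM => //.
  by rewrite linearB /= E subrr.
pose F : 'M[K]_(\dim M) := \matrix_(i, j) coord e j (phi e`_i).
pose X : 'M[K]_(\dim M) := \matrix_(i, j) f (s e`_i) e`_j.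
have phie (i : 'I_(\dim M)) : phi e`_i = \sum_j F i j *: e`_j.
  rewrite [LHS](coord_vbasis (phiM _ (eM i))); apply: eq_bigr => j _.
  by rewrite mxE.
have comb (u : 'rV[K]_(\dim M)) j :
    (u *m X) 0 j = f (s (\sum_i u 0 i *: e`_i)) e`_j.
  rewrite mxE linear_sum (polar_suml quadQ).
  by apply: eq_bigr => i _; rewrite linearZ /= (polarZl quadQ) mxE.
have unitX : X \in unitmx.
  rewrite -row_free_unit -kermx_eq0; apply/rowV0P => u /sub_kermxP uX.
  pose z := \sum_i u 0 i *: e`_i.
  have zM : z \in M by apply: memv_suml => i _; rewrite memvZ.
  have : s z \in perp quadQ M.
    apply/perpPr => y yM; rewrite (coord_vbasis yM).
    rewrite (polar_sumr quadQ) big1 // => j _.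
    by rewrite (polarZr quadQ) -comb uX mxE mulr0.
  rewrite perp_limg_sub1 // memv_ker -/C sK // => /eqP z0.
  apply/rowP=> i; rewrite mxE.
  have /freeP := basis_free (vbasisP M); apply.
  by rewrite -/e -[RHS]z0.
have isoF : F *m X *m F^T = X.
  have FX i k : (F *m X) i k = f (s (phi e`_i)) e`_k.
    have := comb (row i F) k; rewrite -row_mul mxE => ->.
    rewrite [phi _]phie; congr (f (s _) _); apply: eq_bigr => l _.
    by rewrite [row i F 0 l]mxE.
  apply/matrixP=> i j; rewrite mxE [RHS]mxE.
  (* [phi (s e_i)] and [s (phi e_i)] have the same image under [C], so they differ by a vector of
     [lker C], which is orthogonal to [M]. *)
  have -> : f (s e`_i) e`_j = f (s (phi e`_i)) (phi e`_j).
    rewrite -(isomP iphi); apply: eqM; last exact: phiM.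
    by rewrite -phiC !sK ?phiM.
  rewrite [phi e`_j]phie (polar_sumr quadQ); apply: eq_bigr => k _.
  by rewrite (polarZr quadQ) FX [F^T _ _]mxE mulrC.
have := odd_isometry_eigenvalue oddM unitX isoF.
rewrite -eigenvalue_root_char => /eigenvalueP[u uF u0].
pose z := \sum_i u 0 i *: e`_i.
have phiz : phi z = \det F *: z.
  rewrite linear_sum scaler_sumr /=.
  under eq_bigr => i _ do rewrite linearZ /= phie scaler_sumr.
  rewrite exchange_big /=; apply: eq_bigr => j _.
  have /rowP/(_ j) := uF; rewrite !mxE scalerA => <-.
  by rewrite scaler_suml; apply: eq_bigr => i _; rewrite scalerA.
have z0 : z = 0.
  have /eqP := bilinear_isometry_det unitX isoF; rewrite sqrf_eq1.
  case/orP=> /eqP d; rewrite d ?scale1r ?scaleN1r in phiz; auto.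
case/eqP: u0; apply/rowP=> i; rewrite mxE.
by have /freeP := basis_free (vbasisP M); apply; rewrite -/e -[RHS]z0.
Qed.

Lemma perp_limg_adj g (h : 'End(V)) : (forall x y, f (g x) y = f x (h y)) ->
  perp quadQ (limg g) = lker h.
Proof.
move=> adj; apply/vspaceP=> x; rewrite memv_ker; apply/perpP/eqP => [xp|hx].
  by apply: ndefQ => w; rewrite polarC -adj xp ?memv_img ?memvf.
by move=> _ /memv_imgP[y _ ->]; rewrite adj hx (polar0r quadQ).
Qed.

Lemma adj_iter (g h : V -> V) i x y : (forall x y, f (g x) y = f x (h y)) ->
  f (iter i g x) y = f x (iter i h y).
Proof. by move=> adj; elim: i y => //= i IH y; rewrite adj IH -iterSr. Qed.

Lemma quad_sum (I : finType) (F : I -> V) :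
  (forall i, Q (F i) = 0) -> (forall i j, f (F i) (F j) = 0) ->
  Q (\sum_i F i) = 0.
Proof.
move=> QF fF; pose P y := Q y = 0 /\ forall i, f (F i) y = 0.
suff [] : P (\sum_i F i) by [].
apply: big_rec => [|i y _ [Qy fy]].
  by split=> [|i]; rewrite ?(quad0 quadQ) ?(polar0r quadQ).
split=> [|j]; first by rewrite (quadD Q) QF Qy fy !addr0.
by rewrite (polarDr quadQ) fF fy addr0.
Qed.

Section Unipotent.
Variable phi : 'End(V).
Hypothesis iphi : isometry_of Q phi.
Local Notation N := (phi - \1%VF).
Local Notation phiV := (phi^-1)%VF.

Let phiK : cancel phi phiV := isomKV quadQ ndefQ iphi.
Let phiVK : cancel phiV phi := isomVK quadQ ndefQ iphi.

(* The adjoint of [phi - 1] is [phi^-1 - 1 = psi (phi - 1)] where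
   [psi = - phi^-1]. *)
Let psi : 'End(V) := - phiV.

Lemma psi_comm x : psi (N x) = N (psi x).
Proof. by rewrite !opp_lfunE !sub1E linearN linearB /= phiK phiVK opprB opprK addrC. Qed.

Lemma adj_sub1 x y : f (N x) y = f x (psi (N y)).
Proof.
rewrite !sub1E opp_lfunE (polarBl quadQ) isom_adj // -(polarBr quadQ).
by rewrite linearB /= phiK opprB.
Qed.

Lemma adj_iter_sub1 i x y : f (iter i N x) y = f x (iter i psi (iter i N y)).
Proof.
rewrite -iter_compC; last by move=> z; rewrite psi_comm.
by apply: adj_iter => u w; rewrite adj_sub1.
Qed.

Lemma psi_iter_eq0 i x : iter i psi x = 0 -> x = 0.
Proof.
elim: i => //= i IH; rewrite opp_lfunE => /eqP; rewrite oppr_eq0 => /eqP E.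
by apply: IH; rewrite -[LHS]phiVK E linear0.
Qed.

Lemma perp_limg_iter i :
  perp quadQ (limg (lexp N i)) = lker (lexp N i).
Proof.
rewrite (perp_limg_adj (h := (lexp psi i \o lexp N i)%VF)); last first.
  by move=> x y; rewrite comp_lfunE !lexpE adj_iter_sub1.
apply/vspaceP=> x; rewrite !memv_ker comp_lfunE !lexpE.
apply/eqP/eqP=> [/psi_iter_eq0 //|->]; exact: iter0_lin.
Qed.

Lemma perp_lker_iter i :
  perp quadQ (lker (lexp N i)) = limg (lexp N i).
Proof. by rewrite -perp_limg_iter perpK. Qed.

End Unipotent.

(* On the generalized eigenspace of [phi] for 1 this says that no nondegenerate
   [phi]-stable subspace has involutions of both parities inverting [phi]. *)
Definition nonflexible phi := forall m v,
  iter m.*2.+1 (phi - \1%VF) v = 0 -> Q (iter m (phi - \1%VF) v) = 0.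

(* [L], the sum of the [N^m (ker N^(2m+1))] where [N = phi - 1], consists of
   the vectors of weight at most 0 for the weight filtration of [N], and its
   orthogonal of those of negative weight. *)
Lemma unipotent_centralizer_even phi c : isometry_of Q phi -> isometry_of Q c ->
  (forall x, c (phi x) = phi (c x)) ->
  (forall x, iter (dim V) (phi - \1%VF) x = 0) -> nonflexible phi ->
  ~~ odd (\dim (limg (c - \1%VF))).
Proof.
move=> iphi ic cphi; set N := phi - \1%VF; set n := dim V => Nn NF.
pose L := (\sum_(m < n) (lexp N m @: lker (lexp N m.*2.+1)))%VS.
pose psi : 'End(V) := - (phi^-1)%VF.
have memL m v : iter m.*2.+1 N v = 0 -> iter m N v \in L.
  move=> Nv; have [ltm|lem] := ltnP m n; last first.
    by rewrite (iter_eq0_leq lem) ?Nn ?mem0v.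
  apply: (subvP (sumv_sup (Ordinal ltm) isT (subvv _))).
  by rewrite -lexpE memv_img // mem_lker_lexp; apply/eqP.
have fL m l v w : iter m.*2.+1 N v = 0 -> iter l.*2.+1 N w = 0 ->
    f (iter m N v) (iter l N w) = 0.
  wlog leml : m l v w / (m <= l)%N.
    move=> wl Nv Nw; have [le|/ltnW le] := leqP m l; first exact: wl.
    by rewrite polarC wl.
  (* For [m = l] the value is a polarization of [Q] at vectors covered by [NF]. For [m < l], moving
     [N^l] to the other side produces [N^(l+m) v] with [l + m >= 2m + 1]. *)
  move=> Nv Nw; have [eml|neq] := eqVneq m l.
    by rewrite -eml in Nw *; rewrite /polar -iterD_lin !NF ?subr0 // iterD_lin Nv Nw addr0.
  rewrite polarC adj_iter_sub1 // -iterD.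
  have -> : iter (l + m) N v = 0.
    apply: iter_eq0_leq Nv.
    by rewrite -addnn -addSn leq_add2r ltn_neqAle neq.
  by rewrite iter0_lin (polar0r quadQ).
have L_sing x : x \in L -> Q x = 0.
  case/memv_sumP=> xs xsP ->; apply: quad_sum => [i|i j].
    have /memv_imgP[v vK ->] := xsP i isT; rewrite lexpE NF //.
    by apply/eqP; rewrite -mem_lker_lexp.
  have /memv_imgP[v vK ->] := xsP i isT; have /memv_imgP[w wK ->] := xsP j isT.
  by rewrite !lexpE fL //; apply/eqP; rewrite -mem_lker_lexp.
have cN x : c (N x) = N (c x) by rewrite !sub1E linearB /= cphi.
have cL x : x \in L -> c x \in L.
  case/memv_sumP=> xs xsP ->; rewrite linear_sum memv_suml //= => i _.
  have /memv_imgP[v vK ->] := xsP i isT; rewrite lexpE iter_comm // memL //.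
  rewrite mem_lker_lexp in vK.
  by rewrite -iter_comm // (eqP vK) linear0.
have fLL x y : x \in L -> y \in L -> f x y = 0.
  by move=> xL yL; rewrite /polar !L_sing ?memvD // !subr0.
apply: (lagrangian_even (L := L) (quadQ := quadQ) ndefQ ic _ L_sing cL).
apply/eqP; rewrite eqEsubv; apply/andP; split; last first.
  by apply/subvP=> x xL; apply/perpP=> u uL; apply: fLL.
apply/subvP=> x /perpP xp.
suff [y yL] : exists2 y, y \in L & iter 0 N (x - y) = 0.
  by move/subr0_eq => ->.
have : exists2 y, y \in L & iter n N (x - y) = 0 by exists 0; rewrite ?mem0v ?Nn.
(* To see that [L] is its own orthogonal, [x] is reduced modulo [L]. If [N^(j+1) x' = 0] and [x'] is
   orthogonal to [L], then [N^j x'] is orthogonal to [ker N^(2j+1)], hence equals some [N^(2j+1) z];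
   subtracting [N^(j+1) z], which is in [L], makes [N^j] vanish. *)
elim: {1}n => // j IHj [y yL Ny]; apply: IHj.
set x' := x - y in Ny.
have x'p u : u \in L -> f u x' = 0.
  by move=> uL; rewrite (polarBr quadQ) xp // fLL // subr0.
have : iter j N x' \in perp quadQ (lker (lexp N j.*2.+1)).
  apply/perpP=> u; rewrite mem_lker_lexp => /eqP Nu.
  rewrite polarC adj_iter_sub1 // -/psi polarC iter_comm2; last first.
    by move=> w; rewrite psi_comm.
  by apply/x'p/memL; rewrite -iter_comm2 ?Nu ?iter0_lin // => w; rewrite psi_comm.
rewrite perp_lker_iter // => /limg_lexpP[z Nz].
exists (y + iter j.+1 N z).
  rewrite memvD // memL // (iter_eq0_leq (i := j.*2.+2)) ?doubleS //.
  by rewrite iterS -Nz -iterS.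
by rewrite opprD addrA iterB_lin -/x' Nz -iterD addnS addnn subrr.
Qed.

End Centralizer.

(** * Restriction to stable subspaces and the Fitting decomposition *)

Section Restriction.
Variables (K : fieldType) (V : vectType K) (H : {vspace V}).
Implicit Types (g h : 'End(V)) (u : subvs_of H).

Definition vsvalL : 'Hom(subvs_of H, V) := linfun vsval.
Definition vsprojL : 'Hom(V, subvs_of H) := linfun (vsproj H).
Definition restr g : 'End(subvs_of H) := (vsprojL \o g \o vsvalL)%VF.

Lemma vsvalLE u : vsvalL u = vsval u. Proof. by rewrite lfunE. Qed.

Definition stable g := forall x, x \in H -> g x \in H.

Lemma vsval_restr g u : stable g -> vsval (restr g u) = g (vsval u).
Proof. by move=> gH; rewrite !comp_lfunE !lfunE /= vsprojK // gH // subvsP. Qed.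

Lemma restr_sub1 g u : stable g ->
  vsval ((restr g - \1%VF) u) = (g - \1%VF) (vsval u).
Proof. by move=> gH; rewrite !sub1E linearB /= vsval_restr. Qed.

Lemma iter_restr_sub1 g i u : stable g ->
  vsval (iter i (restr g - \1%VF) u) = iter i (g - \1%VF) (vsval u).
Proof. by move=> gH; elim: i => //= i IH; rewrite restr_sub1 // IH. Qed.

Lemma restr_opp g : stable g -> restr (- g) = - restr g.
Proof.
move=> gH; apply/lfunP=> u; apply: subvs_inj.
have gH' : stable (- g) by move=> x xH; rewrite opp_lfunE memvN gH.
by rewrite vsval_restr // !opp_lfunE linearN /= vsval_restr.
Qed.

Lemma dim_restr_sub1 g : stable g ->
  \dim (limg (restr g - \1%VF)) = \dim ((g - \1%VF) @: H).
Proof.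
move=> gH.
have -> : ((g - \1%VF) @: H = vsvalL @: limg (restr g - \1%VF))%VS.
  apply/vspaceP=> x; apply/memv_imgP/memv_imgP.
    case=> y yH ->; exists ((restr g - \1%VF) (vsproj H y)).
      by rewrite memv_img ?memvf.
    by rewrite vsvalLE restr_sub1 // vsprojK.
  case=> _ /memv_imgP[u _ ->] ->; exists (vsval u); first exact: subvsP.
  by rewrite vsvalLE restr_sub1.
rewrite [RHS]limg_dim_eq //; apply/eqP; rewrite -subv0; apply/subvP=> u.
rewrite memv_cap memv0 memv_ker vsvalLE => /andP[_ /eqP u0].
by apply/eqP/subvs_inj; rewrite u0 linear0.
Qed.

End Restriction.

Section QuadraticRestriction.
Variables (K : fieldType) (V : vectType K) (Q : V -> K).
Hypotheses (quadQ : quadratic_form Q) (ndefQ : nondefective Q).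
Local Notation f := (polar Q).
Implicit Types (g c phi : 'End(V)) (H : {vspace V}).

Definition quad_restr H : subvs_of H -> K := fun u => Q (vsval u).

Lemma quad_restrP H : quadratic_form (quad_restr (H := H)).
Proof.
split=> [k v|]; first by rewrite /quad_restr linearZ quadZ.
by split=> [u k v w|u k v w]; rewrite /polar /quad_restr !linearP;
  have := quadQ.2; case=> l r; [apply: l|apply: r].
Qed.

Lemma isometry_restr H g : stable H g -> isometry_of Q g ->
  isometry_of (quad_restr (H := H)) (restr H g).
Proof. by move=> gH ig u; rewrite /quad_restr vsval_restr. Qed.

Definition nondeg H := (H :&: perp quadQ H == 0)%VS.

Lemma nondeg_perp H : nondeg H -> nondeg (perp quadQ H).
Proof. by rewrite /nondeg perpK // capvC. Qed.

Lemma quad_restr_ndef H : nondeg H -> nondefective (quad_restr (H := H)).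
Proof.
move=> /eqP nH u fu; apply: subvs_inj; apply/eqP; rewrite linear0 -memv0 -nH.
rewrite memv_cap subvsP; apply/perpPr => w wH.
by have := fu (vsproj H w); rewrite /polar /quad_restr linearD /= vsprojK.
Qed.

Lemma nondeg_add H : nondeg H -> (H + perp quadQ H)%VS = fullv.
Proof.
move=> /eqP nH; apply/eqP; rewrite eqEdim subvf dimv_disjoint_sum //.
by rewrite addnC dim_perp // dimvf leqnn.
Qed.

Lemma perp_stable H g : isometry_of Q g -> stable H g ->
  stable (perp quadQ H) g.
Proof.
move=> ig gH x /perpPr xp; apply/perpPr=> y yH; rewrite isom_adj // xp //.
by apply: stable_inv yH => //; apply: isom_ker ig.
Qed.

Lemma odd_dim_sub1_split H c : nondeg H -> isometry_of Q c -> stable H c ->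
  odd (\dim (limg (c - \1%VF))) =
  odd (\dim (limg (restr H c - \1%VF))) (+)
  odd (\dim (limg (restr (perp quadQ H) c - \1%VF))).
Proof.
move=> nH ic cH; have cH' := perp_stable ic cH.
rewrite !dim_restr_sub1 // -oddD -(nondeg_add nH) limgD dimv_disjoint_sum //.
apply/eqP; rewrite -subv0 -(eqP nH) capvS //.
  by apply/subvP=> _ /memv_imgP[x xH ->]; rewrite sub1E memvB ?cH.
by apply/subvP=> _ /memv_imgP[x xH ->]; rewrite sub1E memvB ?cH'.
Qed.

Section Fitting.
Variables (phi c : 'End(V)).
Hypotheses (iphi : isometry_of Q phi) (ic : isometry_of Q c).
Hypothesis cphi : forall x, c (phi x) = phi (c x).
Local Notation N := (phi - \1%VF).
Local Notation H := (lker (lexp N (dim V))).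

Lemma perp_fitting : perp quadQ H = limg (lexp N (dim V)).
Proof. exact: perp_lker_iter. Qed.

Lemma nondeg_fitting : nondeg H.
Proof. by rewrite /nondeg perp_fitting fitting_cap. Qed.

Lemma stable_fitting : stable H c.
Proof.
move=> x; rewrite !mem_lker_lexp => /eqP Nx.
by rewrite -iter_comm ?Nx ?linear0 // => y; rewrite !sub1E linearB /= cphi.
Qed.

End Fitting.
End QuadraticRestriction.

Section CentralizerEven.
Variables (K : fieldType).

Lemma nonflexible_restr (V : vectType K) (Q : V -> K) (H : {vspace V})
    (phi : 'End(V)) :
  stable H phi -> nonflexible Q phi ->
  nonflexible (quad_restr Q (H := H)) (restr H phi).
Proof.
move=> pH NF m u Nu; rewrite /quad_restr iter_restr_sub1 // NF //.
by rewrite -iter_restr_sub1 // Nu.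
Qed.

Lemma dim_subvs (V : vectType K) (H : {vspace V}) : dim (subvs_of H) = \dim H.
Proof. by []. Qed.

(** Splits off the generalized eigenspace for 1, on which [c] is even. The conclusion returns the
    hypotheses on the complement because the lemma is applied twice: to [phi], then to [- phi] on
    what is left. *)
Lemma centralizer_even_fitting (V : vectType K) (Q : V -> K)
    (quadQ : quadratic_form Q) (ndefQ : nondefective Q) (phi c : 'End(V)) :
  isometry_of Q phi -> isometry_of Q c -> (forall x, c (phi x) = phi (c x)) ->
  nonflexible Q phi ->
  let H' := limg (lexp (phi - \1%VF) (dim V)) in
  stable H' phi /\ stable H' c /\ nondefective (quad_restr Q (H := H')) /\
  odd (\dim (limg (c - \1%VF))) = odd (\dim (limg (restr H' c - \1%VF))) /\
  forall u, restr H' phi u = u -> u = 0.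
Proof.
move=> iphi ic cphi NF /=; set N := phi - \1%VF.
set H := lker (lexp N (dim V)); set H' := limg (lexp N (dim V)).
have eH' : H' = perp quadQ H by rewrite perp_fitting.
have nH : nondeg quadQ H by apply: nondeg_fitting.
have sphi : stable H phi by apply: stable_fitting.
have sc : stable H c by apply: stable_fitting.
split; first by rewrite eH'; apply: perp_stable.
split; first by rewrite eH'; apply: perp_stable.
split; first by rewrite eH'; apply: quad_restr_ndef; apply: nondeg_perp.
split.
  rewrite (odd_dim_sub1_split ndefQ nH ic sc) -eH'.
  suff /negPf-> : ~~ odd (\dim (limg (restr H c - \1%VF))) by [].
  apply: (@unipotent_centralizer_even _ _ _ (quad_restrP quadQ H)
    (quad_restr_ndef nH) (restr H phi)).
  - exact: isometry_restr.
  - exact: isometry_restr.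
  - by move=> u; apply: subvs_inj; rewrite !vsval_restr.
  - move=> u; apply: (@ker_iter_stab _ _ _ (dim V)).
    apply: subvs_inj; rewrite iter_restr_sub1 // linear0; apply/eqP.
    by rewrite -mem_lker_lexp subvsP.
  - exact: nonflexible_restr.
move=> u; move/(congr1 vsval); rewrite vsval_restr; last first.
  by rewrite eH'; apply: perp_stable.
move=> phiu; apply: subvs_inj; rewrite linear0; apply/eqP.
rewrite -memv0 -(fitting_cap N) memv_cap subvsP andbT mem_lker_lexp.
have Nu : N (vsval u) = 0 by rewrite sub1E phiu subrr.
have [d0|dp] := posnP (dim V); last first.
  by rewrite (iter_eq0_leq dp) //= Nu.
by have := memvf (vsval u); rewrite -(dimvf V) in d0; move/eqP: d0; rewrite dimv_eq0 => /eqP->;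
  rewrite memv0 => /eqP ->; rewrite iter0_lin.
Qed.

Lemma centralizer_even (V : vectType K) (Q : V -> K)
    (quadQ : quadratic_form Q) (ndefQ : nondefective Q) (phi c : 'End(V)) :
  isometry_of Q phi -> isometry_of Q c -> (forall x, c (phi x) = phi (c x)) ->
  nonflexible Q phi -> nonflexible Q (- phi) ->
  ~~ odd (\dim (limg (c - \1%VF))).
Proof.
move=> iphi ic cphi NF NFN.
have [sphi [sc [ndef1 [-> fix1]]]] := centralizer_even_fitting quadQ ndefQ iphi ic cphi NF.
set H1 := limg _ in sphi sc ndef1 fix1 *.
have iphi1 : isometry_of (quad_restr Q (H := H1)) (- restr H1 phi).
  by apply: isom_opp; [apply: quad_restrP | apply: isometry_restr].
have ic1 := isometry_restr sc ic.
have cphi1 u : restr H1 c ((- restr H1 phi) u) = (- restr H1 phi) (restr H1 c u).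
  apply: subvs_inj; rewrite vsval_restr // !opp_lfunE ![vsval (- _)]linearN /=.
  by rewrite !vsval_restr // linearN /= cphi.
have NF1 : nonflexible (quad_restr Q (H := H1)) (- restr H1 phi).
  rewrite -restr_opp //; apply: nonflexible_restr => //.
  by move=> x xH; rewrite opp_lfunE memvN sphi.
have [sphi2 [sc2 [ndef2 [-> fix2]]]] :=
  centralizer_even_fitting (quad_restrP quadQ H1) ndef1 iphi1 ic1 cphi1 NF1.
set H2 := limg _ in sphi2 sc2 ndef2 fix2 *.
apply: (nofix_centralizer_even (quad_restrP (quad_restrP quadQ H1) H2) ndef2
  (isometry_restr sphi2 iphi1) (isometry_restr sc2 ic1)) => //.
- by move=> u; apply: subvs_inj; rewrite !vsval_restr.
- move=> u /(congr1 vsval); rewrite vsval_restr // linearN /= opp_lfunE.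
  move/oppr_inj/fix1 => u0; apply: subvs_inj; exact: u0.
Qed.

End CentralizerEven.

(** * Inverting involutions built from totally singular graphs *)

(** Invariance under [g] reduces [f (g^i w) (g^j w')] to a pairing of an element of [W] with an
    iterate, so singularity need only be tested on generators. *)
Lemma cycs_singular (K : fieldType) (V : vectType K) (Q : V -> K)
    (quadQ : quadratic_form Q) (g : 'End(V)) (W : {vspace V}) :
  isometry_of Q g -> lker g = 0%VS -> (forall w, w \in W -> Q w = 0) ->
  (forall w w' i, w \in W -> w' \in W -> polar Q w (iter i g w') = 0) ->
  forall x, x \in cycs g W -> Q x = 0.
Proof.
move=> ig kg QW fW.
have S1 : forall x, x \in cycs g W -> forall w i, w \in W -> polar Q w (iter i g x) = 0.
  apply: cycs_ind => [w i wW|x y Px Py w i wW|x xW w i wW|x Px w i wW].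
  - by rewrite iter0_lin (polar0r quadQ).
  - by rewrite iterD_lin (polarDr quadQ) Px // Py // addr0.
  - exact: fW.
  - by rewrite -iterSr Px.
have S2 : forall x, x \in cycs g W -> forall y, y \in cycs g W -> polar Q x y = 0.
  apply: cycs_ind => [y _|x x' Px Px' y yC|x xW y yC|x Px y yC].
  - exact: (polar0l quadQ).
  - by rewrite (polarDl quadQ) Px // Px' // addr0.
  - exact: (S1 y yC x 0%N).
  have yE : g ((g^-1)%VF y) = y by rewrite lker0_lfunVK // kg.
  rewrite -yE isomP // Px //; apply: (stable_inv kg _ yC).
  by move=> z; apply: cycs_stable.
suff: forall x, x \in cycs g W -> x \in cycs g W /\ Q x = 0 by move=> E x /E[].
apply: cycs_ind => [|x y [xC Qx] [yC Qy]|x xW|x [xC Qx]].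
- by rewrite mem0v (quad0 quadQ).
- by rewrite memvD // (quadD Q) Qx Qy S2 // !addr0.
- by rewrite QW // (subvP (sub_cycs _ _)).
- by rewrite ig cycs_stable.
Qed.

Section Inverter.
Variables (K : fieldType) (V : vectType K) (Q : V -> K).
Hypotheses (quadQ : quadratic_form Q) (ndefQ : nondefective Q).
Variable (phi : 'End(V)).
Hypothesis iphi : isometry_of Q phi.
Local Notation f := (polar Q).
Local Notation phiV := (phi^-1)%VF.
Implicit Types (H : {vspace V}) (sigma : 'End(V)).

Let phiK : cancel phi phiV := isomKV quadQ ndefQ iphi.
Let phiVK : cancel phiV phi := isomVK quadQ ndefQ iphi.

(* [phi sigma phi = sigma] says that [sigma phi sigma = phi^-1]. *)
Definition inverter_on H sigma :=
  [/\ stable H sigma, forall x, x \in H -> sigma (sigma x) = x,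
      forall x, x \in H -> phi (sigma (phi x)) = sigma x
    & forall x, x \in H -> Q (sigma x) = Q x].

Local Notation VV := (V * V)%type.

(** The graph of a linear map [sigma] with [sigma phi = phi^-1 sigma] is stable under this step, so
    it is generated by the values of [sigma] on generators. *)
Lemma graph_step_linear :
  linear (fun z : VV => (phi z.1, phiV z.2) : VV).
Proof. by move=> k [x1 x2] [y1 y2] /=; congr pair; rewrite linearP. Qed.
Definition graph_step : 'End(VV) := lmap graph_step_linear.
Lemma graph_stepE z : graph_step z = (phi z.1, phiV z.2).
Proof. by rewrite lmapE. Qed.

Lemma iter_graph_step i z :
  iter i graph_step z = (iter i phi z.1, iter i phiV z.2).
Proof. by elim: i => [|i IH] /=; [case: z | rewrite graph_stepE IH]. Qed.

Definition fstL : 'Hom(VV, V) := linfun fst.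
Definition sndL : 'Hom(VV, V) := linfun snd.

Lemma fstLE z : fstL z = z.1. Proof. by rewrite lfunE. Qed.

(** A graph is totally singular for this form exactly when its map preserves [Q]. *)
Definition graph_quad (z : VV) := Q z.1 - Q z.2.

Lemma polar_graph_quad z z' :
  polar graph_quad z z' = f z.1 z'.1 - f z.2 z'.2.
Proof. by rewrite /polar /graph_quad /=; ring. Qed.

Lemma graph_quadP : quadratic_form graph_quad.
Proof.
split=> [k z|]; first by rewrite /graph_quad /= !(quadZ quadQ); ring.
split=> [u k v w|u k v w]; rewrite !polar_graph_quad /=.
  by rewrite !(polarDl quadQ) !(polarZl quadQ); ring.
by rewrite !(polarDr quadQ) !(polarZr quadQ); ring.
Qed.

Lemma graph_step_ker : lker graph_step = 0%VS.
Proof.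
apply/eqP/lker0P => z z'; rewrite !graph_stepE => -[/(can_inj phiK) E1 E2].
by move: E1 (can_inj phiVK E2); case: z z' {E2} => [a b] [c d] /= -> ->.
Qed.

Lemma graph_step_isometry : isometry_of graph_quad graph_step.
Proof.
move=> z; rewrite graph_stepE /graph_quad /= iphi.
by rewrite (isom_inv quadQ ndefQ iphi).
Qed.

Section Graph.
Variable W : {vspace VV}.
Local Notation G := (cycs graph_step W).
Hypothesis QW : forall w, w \in W -> Q w.1 = Q w.2.
Hypothesis fW : forall w w' i, w \in W -> w' \in W ->
  f w.1 (iter i phi w'.1) = f w.2 (iter i phiV w'.2).
Hypothesis swapW : forall w, w \in W -> (w.2, w.1) \in G.
Hypothesis ndG : nondeg quadQ (fstL @: G).

Let QG z : z \in G -> Q z.1 = Q z.2.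
Proof.
move=> zG; apply/eqP; rewrite -subr_eq0; apply/eqP; move: z zG.
apply: (cycs_singular graph_quadP graph_step_isometry graph_step_ker).
  by move=> w wW; rewrite /graph_quad QW ?subrr.
move=> w w' i wW w'W.
by rewrite polar_graph_quad iter_graph_step /= fW // subrr.
Qed.

Let swapG : forall z, z \in G -> (z.2, z.1) \in G.
Proof.
apply: cycs_ind => [|z z' zG z'G|//|z zG]; first exact: mem0v.
  exact: (memvD zG z'G).
(* The swap of coordinates conjugates [graph_step] to its inverse, which also stabilizes [G]. *)
have -> : ((graph_step z).2, (graph_step z).1) = (graph_step^-1)%VF (z.2, z.1).
  rewrite -[LHS](lker0_lfunK (f := graph_step)) ?graph_step_ker //.
  by rewrite !graph_stepE /= phiK phiVK.
by apply: stable_inv zG => [|x]; [exact: graph_step_ker | exact: cycs_stable].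
Qed.

Let fG z z' : z \in G -> z' \in G -> f z.1 z'.1 = f z.2 z'.2.
Proof.
move=> zG z'G; have := QG (memvD zG z'G).
by rewrite /polar /= !QG // => ->.
Qed.

Let memG1 z : z \in G -> z.1 \in (fstL @: G)%VS.
Proof.
by move=> zG; have := memv_img fstL zG; rewrite lfunE.
Qed.

(** By the swap [z.2] lies in the projection of [G]; it is orthogonal to this projection, since
    [f z.2 z'.2 = f z.1 z'.1 = 0]. Nondegeneracy concludes. *)
Let funG z : z \in G -> z.1 = 0 -> z.2 = 0.
Proof.
move=> zG z1; have z2H := memG1 (swapG zG).
apply/eqP; rewrite -memv0 -(eqP ndG) memv_cap z2H /=.
apply/perpP=> _ /memv_imgP[z' z'G ->]; rewrite lfunE polarC.
by have := fG zG (swapG z'G); rewrite z1 (polar0l quadQ) /= => <-.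
Qed.

Lemma graph_inverter :
  exists2 sigma, inverter_on (fstL @: G) sigma
    & forall z, z \in G -> sigma z.1 = z.2.
Proof.
pose F := (fstL \o projv G)%VF.
(* The second coordinate of an arbitrarily chosen element of [G] above the argument; [funG] makes it
   independent of the choice. *)
pose sigma := (sndL \o projv G \o F^-1)%VF.
have sG z : z \in G -> sigma z.1 = z.2.
  move=> zG; have Fz : F z = z.1 by rewrite comp_lfunE projv_id // lfunE.
  have : F ((F^-1)%VF z.1) = z.1.
    by apply: limg_lfunVK; rewrite -Fz memv_img ?memvf.
  rewrite !comp_lfunE lfunE [sndL _]lfunE /=; set t := projv _ _ => t1.
  have tG : t \in G by apply: memv_proj.
  apply/eqP; rewrite -subr_eq0; apply/eqP.
  by apply: (funG (memvB tG zG)); rewrite /= t1 subrr.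
exists sigma => //; split; move=> _ /memv_imgP[z zG ->]; rewrite fstLE ?sG //.
- exact: memG1 (swapG zG).
- exact: sG (swapG zG).
- have := sG _ (cycs_stable zG).
  by rewrite graph_stepE /= => ->; rewrite phiVK.
- by rewrite QG.
Qed.

End Graph.

Lemma pair_inverter (a a' b b' : V) :
  Q a = Q a' -> Q b = Q b' ->
  (forall i, f a (iter i phi a) = f a' (iter i phiV a')) ->
  (forall i, f a (iter i phi b) = f a' (iter i phiV b')) ->
  (forall i, f b (iter i phi a) = f b' (iter i phiV a')) ->
  (forall i, f b (iter i phi b) = f b' (iter i phiV b')) ->
  (a', a) \in (cyc graph_step (a, a') + cyc graph_step (b, b'))%VS ->
  (b', b) \in (cyc graph_step (a, a') + cyc graph_step (b, b'))%VS ->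
  nondeg quadQ (cyc phi a + cyc phi b) ->
  exists2 sigma, inverter_on (cyc phi a + cyc phi b) sigma
    & sigma a = a' /\ sigma b = b'.
Proof.
move=> Qa Qb faa fab fba fbb sa sb nd.
pose W := (<[(a, a') : VV]> + <[(b, b') : VV]>)%VS.
have eG : cycs graph_step W = (cyc graph_step (a, a') + cyc graph_step (b, b'))%VS.
  exact: cyc_addW.
have eH : (fstL @: cycs graph_step W = cyc phi a + cyc phi b)%VS.
  rewrite eG limgD !(@img_cyc _ _ _ fstL _ phi) ?fstLE //;
  by move=> y; rewrite !fstLE graph_stepE.
have WP w : w \in W -> exists k l, w = (k *: a + l *: b, k *: a' + l *: b').
  by case/memv_addP=> _ /vlineP[k ->] [_ /vlineP[l ->] ->]; exists k, l.
have [||||sigma sH sG] := @graph_inverter W.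
- move=> _ /WP[k [l ->]] /=; rewrite !(quadD Q) !(quadZ quadQ) Qa Qb.
  rewrite !(polarZl quadQ) !(polarZr quadQ).
  by have := fab 0%N; rewrite /= => ->.
- move=> _ _ i /WP[k [l ->]] /WP[k' [l' ->]] /=.
  rewrite !iterD_lin !iterZ_lin !(polarDl quadQ) !(polarDr quadQ).
  by rewrite !(polarZl quadQ) !(polarZr quadQ) faa fab fba fbb.
- move=> _ /WP[k [l ->]] /=; rewrite eG.
  rewrite -[X in X \in _]/(k *: (a', a) + l *: (b', b) : VV).
  by rewrite memvD // memvZ.
- by rewrite eH.
exists sigma; first by rewrite -eH.
have inW z : z \in W -> sigma z.1 = z.2.
  by move=> zW; rewrite sG // (subvP (sub_cycs _ _)).
split; first by apply: (inW (a, a')); rewrite (subvP (addvSl _ _)) ?memv_line.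
by apply: (inW (b, b')); rewrite (subvP (addvSr _ _)) ?memv_line.
Qed.

Lemma iter_phiV_adj i x y : f x (iter i phiV y) = f (iter i phi x) y.
Proof. by rewrite (adj_iter _ _ _ (fun x y => isom_adj quadQ ndefQ x y iphi)). Qed.

Lemma iter_phi_adj i x y : f x (iter i phi y) = f (iter i phiV x) y.
Proof. by rewrite (adj_iter _ _ _ (fun x y => isom_adjV quadQ ndefQ x y iphi)). Qed.

(** On a cyclic space [a(phi) v] can be sent to [a(phi^-1) v], because
    [f v (phi^i v) = f v (phi^-i v)] always holds. The second generator is taken to be 0. *)
Lemma cyc_inverter v : nondeg quadQ (cyc phi v) ->
  exists2 sigma, inverter_on (cyc phi v) sigma & sigma v = v.
Proof.
move=> nd; have e0 : (cyc phi v + cyc phi 0 = cyc phi v)%VS.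
  apply/addv_idPl/cyc_min; first exact: mem0v.
  by move=> x; apply: cycs_stable.
have [|||||||||sigma sH [sv _]] := @pair_inverter v v 0 0; rewrite ?e0 //.
- by move=> i; rewrite iter_phiV_adj polarC.
- by move=> i; rewrite !iter0_lin !(polar0r quadQ).
- by move=> i; rewrite !(polar0l quadQ).
- by move=> i; rewrite !(polar0l quadQ).
- by rewrite (subvP (addvSl _ _)) ?mem_cyc.
- exact: mem0v.
by exists sigma; rewrite // -e0.
Qed.

Lemma glue_inverter H s1 s2 : nondeg quadQ H -> stable H phi ->
  inverter_on H s1 -> inverter_on (perp quadQ H) s2 ->
  exists sigma, [/\ inverter_on fullv sigma, {in H, sigma =1 s1}
    & {in perp quadQ H, sigma =1 s2}].
Proof.
move=> nH pH [st1 inv1 rev1 iso1] [st2 inv2 rev2 iso2].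
pose H' := perp quadQ H.
have capH : (H :&: H' = 0)%VS by apply/eqP.
have capH' : (H' :&: H = 0)%VS by rewrite capvC.
pose sigma := ((s1 \o daddv_pi H H') + (s2 \o daddv_pi H' H))%VF.
have piD x y : x \in H -> y \in H' ->
    daddv_pi H H' (x + y) = x /\ daddv_pi H' H (x + y) = y.
  move=> xH yH.
  have := daddv_pi_add capH (subvP (addvSl H H') _ xH).
  rewrite daddv_pi_id // -[X in _ = X -> _]addr0 => /addrI x0.
  have := daddv_pi_add capH (subvP (addvSr H H') _ yH).
  rewrite [X in _ + X]daddv_pi_id // -[X in _ = X -> _]add0r => /addIr y0.
  by rewrite !linearD /= x0 y0 !daddv_pi_id // addr0 add0r.
have sE x y : x \in H -> y \in H' -> sigma (x + y) = s1 x + s2 y.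
  by move=> xH yH; rewrite /sigma add_lfunE !comp_lfunE; have [-> ->] := piD x y xH yH.
have dec z : exists x y, [/\ x \in H, y \in H' & z = x + y].
  have := memvf z; rewrite -(nondeg_add ndefQ nH).
  by case/memv_addP=> x xH [y yH ->]; exists x, y.
have pH' : stable H' phi := perp_stable ndefQ iphi pH.
exists sigma; split; last 2 first.
- by move=> x xH; rewrite -[x]addr0 sE ?mem0v // linear0 !addr0.
- by move=> x xH; rewrite -[x]add0r sE ?mem0v // linear0 !add0r.
split=> z; first by rewrite !memvf.
- have [x [y [xH yH ->]]] := dec z => _.
  by rewrite !sE ?inv1 ?inv2 //; [apply: st1|apply: st2].
- have [x [y [xH yH ->]]] := dec z => _.
  have -> : phi (x + y) = phi x + phi y by rewrite linearD.
  rewrite (sE _ _ (pH _ xH) (pH' _ yH)) sE // linearD /=.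
  by congr (_ + _); [exact: rev1|exact: rev2].
have [x [y [xH yH ->]]] := dec z => _.
rewrite sE // !(quadD Q) iso1 // iso2 //.
have fH u w : u \in H -> w \in H' -> f u w = 0 by move=> uH /perpP; apply.
by rewrite !fH //; [apply: st1|apply: st2].
Qed.

End Inverter.

Lemma transport_inverter (K : fieldType) (V : vectType K) (Q : V -> K)
    (H : {vspace V}) (phi : 'End(V)) (s : 'End(subvs_of H)) :
  stable H phi -> inverter_on (quad_restr Q (H := H)) (restr H phi) fullv s ->
  inverter_on Q phi H (vsvalL H \o s \o vsprojL H)%VF.
Proof.
move=> pH [_ invs revs isos]; set s' := (_ \o _)%VF.
have s'E x : s' x = vsval (s (vsproj H x)).
  by rewrite !comp_lfunE vsvalLE lfunE.
split=> x xH; rewrite !s'E; first exact: subvsP.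
- by rewrite vsvalK invs ?memvf ?vsprojK.
- rewrite -(revs (vsproj H x)) ?memvf // vsval_restr //.
  congr (phi (vsval (s _))); apply: subvs_inj.
  by rewrite vsval_restr // !vsprojK // pH.
- by rewrite -[RHS](congr1 Q (vsprojK xH)); apply: isos; rewrite memvf.
Qed.

(** * Cyclic modules *)

Section PolyAction.
Variables (K : fieldType) (V : vectType K) (g : 'End(V)).
Implicit Types (p q r : {poly K}) (x y u v : V).

Definition pact p : 'End(V) := \sum_(i < size p) p`_i *: lexp g i.

Lemma pactE n p x : (size p <= n)%N ->
  pact p x = \sum_(i < n) p`_i *: iter i g x.
Proof.
move=> lepn; rewrite sum_lfunE (big_ord_widen n (fun i => (p`_i *: lexp g i) x)) //.
rewrite big_mkcond /=; apply: eq_bigr => i _; case: ltnP => [_|le].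
  by rewrite scale_lfunE lexpE.
by rewrite nth_default // scale0r.
Qed.

Lemma pactD p q x : pact (p + q) x = pact p x + pact q x.
Proof.
rewrite !(@pactE (maxn (size p) (size q))) ?leq_maxl ?leq_maxr ?size_polyD //.
by rewrite -big_split; apply: eq_bigr => i _; rewrite coefD scalerDl.
Qed.

Lemma pactC c x : pact c%:P x = c *: x.
Proof. by rewrite (@pactE 1) ?size_polyC_leq1 // big_ord1 coefC. Qed.

Lemma pact0 x : pact 0 x = 0.
Proof. by rewrite (@pactE 0) ?size_poly0 // big_ord0. Qed.

Lemma pactMX p x : pact (p * 'X) x = g (pact p x).
Proof.
rewrite (@pactE (size p).+1); last first.
  by rewrite (leq_trans (size_polyMleq _ _)) // size_polyX addn2.
rewrite big_ord_recl coefMX eqxx scale0r add0r (pactE x (leqnn _)) linear_sum.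
by apply: eq_bigr => i _; rewrite coefMX linearZ.
Qed.

Lemma pact_comm (h : 'End(V)) p x :
  (forall y, h (g y) = g (h y)) -> h (pact p x) = pact p (h x).
Proof.
move=> hg; rewrite !(pactE _ (leqnn _)) linear_sum; apply: eq_bigr => i _.
by rewrite linearZ /= iter_comm.
Qed.

Lemma pactM p q x : pact (p * q) x = pact p (pact q x).
Proof.
elim/poly_ind: p => [|p c IH]; first by rewrite mul0r !pact0.
rewrite mulrDl mulrAC !pactD !pactMX IH pactC; congr (_ + _).
rewrite (@pactE (size q) (c%:P * q)) ?mul_polyC ?size_scale_leq //.
rewrite (pactE _ (leqnn (size q))) scaler_sumr; apply: eq_bigr => i _.
by rewrite coefZ scalerA.
Qed.

Lemma pact_pact p q x : pact p (pact q x) = pact q (pact p x).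
Proof. by rewrite -!pactM mulrC. Qed.

Lemma pact_cyc p u : pact p u \in cyc g u.
Proof.
rewrite (pactE _ (leqnn _)) memv_suml // => i _; rewrite memvZ //.
by apply: iter_stable (mem_cyc _ _) => x; apply: cycs_stable.
Qed.

Lemma cyc_pact u x : x \in cyc g u -> exists p, x = pact p u.
Proof.
move: x; apply: cyc_ind => [|y z [p ->] [q ->]|a|y [p ->]].
- by exists 0; rewrite pact0.
- by exists (p + q); rewrite pactD.
- by exists a%:P; rewrite pactC.
- by exists (p * 'X); rewrite pactMX.
Qed.

Lemma pact_stable (X : {vspace V}) p x :
  (forall y, y \in X -> g y \in X) -> x \in X -> pact p x \in X.
Proof.
move=> gX xX; rewrite (pactE _ (leqnn _)) memv_suml // => i _.
by rewrite memvZ // iter_stable.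
Qed.

Lemma pactXsub1 x : pact ('X - 1%:P) x = (g - \1%VF) x.
Proof.
by rewrite -polyCN -['X]mul1r pactD pactMX pactC !pactC scale1r scaleN1r sub1E.
Qed.

(* Such a [p] is irreducible, and minimality replaces all uses of that fact:
   a polynomial not divisible by [p] is injective on [ker p(g)]. *)
Definition minimal_kernel p := p != 0 /\
  forall r x, r != 0 -> (size r < size p)%N -> pact r x = 0 -> x = 0.

(* If [p(g)^(k+1) u = 0] then [cyc g u] is a uniserial module with socle
   generated by [p(g)^k u]. *)
Lemma uniserial p k u (R : {vspace V}) : minimal_kernel p ->
  iter k.+1 (pact p) u = 0 -> (R <= cyc g u)%VS ->
  (forall x, x \in R -> g x \in R) -> R != 0%VS -> iter k (pact p) u \in R.
Proof.
move=> [p0 minp] Pk Ru gR; apply: contraR => PkR.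
have Pcyc i x : x \in cyc g u -> iter i (pact p) x = pact (p ^+ i) x.
  by move=> _; elim: i => [|i IH]; rewrite ?expr0 ?pactC ?scale1r // exprS pactM -IH.
have PcomC i a x : iter i (pact p) (pact a x) = pact a (iter i (pact p) x).
  by apply: esym; apply: iter_comm => y; rewrite pact_pact.
rewrite -subv0; apply/subvP=> z zR; rewrite memv0.
(* If [R] misses [p^k u], its elements are divisible by ever higher powers of [p]. Otherwise take
   [z = p^j a u] with [r = a mod p] nonzero: [R] contains [p^(k-j) z = r p^k u], and [r], being
   injective, maps the cyclic space of [p^k u] onto itself, which puts [p^k u] in [R]. *)
suff /(_ k.+1 (leqnn _)) [a ->] : forall j, (j <= k.+1)%N ->
    exists a, z = iter j (pact p) (pact a u).
  by rewrite PcomC Pk linear0.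
elim=> [_|j IH ltj]; first by have [a ->] := cyc_pact (subvP Ru z zR); exists a.
have [a zE] := IH (ltnW ltj).
have aE : pact a u = pact p (pact (a %/ p) u) + pact (a %% p) u.
  by rewrite -pactM mulrC -pactD -divp_eq.
have [r0|r0] := eqVneq (a %% p) 0.
  by exists (a %/ p); rewrite zE aE r0 pact0 addr0 iterSr.
case/negP: PkR; set y := iter k (pact p) u; set r := a %% p in r0 aE.
have ryR : pact r y \in R.
  have -> : pact r y = iter (k - j) (pact p) z.
    rewrite zE -iterD subnK // aE iterD_lin -iterSr !PcomC Pk linear0 add0r.
    by rewrite -PcomC.
  by apply: iter_stable zR => x xR; apply: pact_stable.
have inj_r x : pact r x = 0 -> x = 0 by apply: minp; rewrite ?ltn_modp.
have ry_cyc : (cyc g (pact r y) <= cyc g y)%VS.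
  by apply: cyc_min => [|x]; [exact: pact_cyc | exact: cycs_stable].
have : (cyc g (pact r y) == cyc g y)%VS.
  have kC : (cyc g y :&: lker (pact r) = 0)%VS.
    apply/eqP; rewrite -subv0; apply/subvP=> x.
    by rewrite memv_cap memv_ker memv0 => /andP[_ /eqP/inj_r ->].
  rewrite eqEdim ry_cyc -(limg_dim_eq kC) (@img_cyc _ _ _ (pact r) g g) ?leqnn // => x.
  by rewrite pact_comm.
move/eqP=> eC; have : y \in cyc g (pact r y) by rewrite eC mem_cyc.
by apply/subvP/cyc_min.
Qed.

End PolyAction.

Lemma minimal_kernel_sub1 (K : fieldType) (V : vectType K) (g : 'End(V)) :
  minimal_kernel g ('X - 1%:P).
Proof.
split=> [|r x r0]; first by rewrite polyXsubC_eq0.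
rewrite size_XsubC ltnS => /size1_polyC rE; rewrite rE pactC => /eqP.
rewrite scaler_eq0 => /orP[/eqP c0|/eqP->//].
by rewrite rE c0 eqxx in r0.
Qed.

(** * Nondegeneracy of spans of one or two cyclic subspaces *)

Section NondegenerateSpan.
Variables (K : fieldType) (V : vectType K) (Q : V -> K).
Hypotheses (quadQ : quadratic_form Q) (ndefQ : nondefective Q).
Variable (phi : 'End(V)).
Hypothesis iphi : isometry_of Q phi.
Local Notation f := (polar Q).
Local Notation phiV := (phi^-1)%VF.
Local Notation N := (phi - \1%VF).
Implicit Types (u v w x y z : V) (U : {vspace V}).

Let phiK : cancel phi phiV := isomKV quadQ ndefQ iphi.
Let phiVK : cancel phiV phi := isomVK quadQ ndefQ iphi.

Lemma stable_cyc g v : stable (cyc g v) g.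
Proof. by move=> x; apply: cycs_stable. Qed.

Lemma stable_add U1 U2 g : stable U1 g -> stable U2 g ->
  stable (U1 + U2 : {vspace V}) g.
Proof.
move=> s1 s2 _ /memv_addP[x xU [y yU ->]].
by rewrite linearD memv_add ?s1 ?s2.
Qed.

(** The radical is a submodule, so if nonzero it contains the socle generator [p^k u], and with it
    [y]. A general [y] is allowed because [u] may pair with a translate of [p^k u] only. *)
Lemma cyc_nondeg p k u y : minimal_kernel phi p ->
  iter k.+1 (pact phi p) u = 0 -> y \in cyc phi (iter k (pact phi p) u) ->
  f y u != 0 -> nondeg quadQ (cyc phi u).
Proof.
move=> minp Pk yC; apply: contraR => nd.
set R := (cyc phi u :&: perp quadQ (cyc phi u))%VS in nd.
have gR : stable R phi.
  move=> x; rewrite !memv_cap => /andP[xC xp]; rewrite stable_cyc //=.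
  exact: (perp_stable ndefQ iphi (@stable_cyc phi u)).
have := uniserial minp Pk (capvSl _ _) gR nd => PkR.
have /memv_capP[_ /perpPr yp] := subvP (cyc_min PkR gR) y yC.
by rewrite yp ?mem_cyc.
Qed.

(** A radical vector [x + y] has [x] orthogonal to [cyc phi w] and [y] to [cyc phi u]; a nonzero
    submodule of such vectors would contain a socle generator. For [w] the socle is taken with
    respect to [phi^-1], because the form pairs [p(phi)] with [p(phi^-1)]. *)
Lemma isotropic_pair_nondeg p k u w :
  minimal_kernel phi p -> minimal_kernel phiV p ->
  (forall x y, x \in cyc phi u -> y \in cyc phi u -> f x y = 0) ->
  (forall x y, x \in cyc phi w -> y \in cyc phi w -> f x y = 0) ->
  iter k.+1 (pact phi p) u = 0 -> iter k.+1 (pact phiV p) w = 0 ->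
  f (iter k (pact phi p) u) w != 0 -> f u (iter k (pact phiV p) w) != 0 ->
  nondeg quadQ (cyc phi u + cyc phi w).
Proof.
move=> minp minp' isou isow Pu Pw fuw fuw'.
have eqw : cyc phiV w = cyc phi w.
  apply/eqP; rewrite eqEsubv !cyc_min ?mem_cyc //.
    have kV : lker phiV = 0%VS by apply: isom_ker (isom_inv quadQ ndefQ iphi).
    move=> x xC; have -> : phi x = (phiV^-1)%VF x.
      by rewrite -{2}(phiK x) (lker0_lfunK (f := phiV)) // kV.
    exact: stable_inv kV (@stable_cyc phiV w) _ xC.
  by move=> x; apply: stable_inv; [apply: isom_ker iphi | apply: stable_cyc].
rewrite /nondeg -subv0; apply/subvP=> z.
rewrite memv_cap memv0 perpD => /andP[/memv_addP[x xC [y yC ->]]].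
rewrite memv_cap => /andP[/perpPr zu /perpPr zw].
have sub_perp U1 v : stable U1 phi -> stable (U1 :&: perp quadQ (cyc phi v)) phi.
  move=> sU t; rewrite !memv_cap => /andP[/sU-> /=].
  exact: (perp_stable ndefQ iphi (@stable_cyc phi v)).
have x0 : x = 0.
  have [R0|R0] := eqVneq (cyc phi u :&: perp quadQ (cyc phi w))%VS 0%VS.
    apply/eqP; rewrite -memv0 -R0 memv_cap xC; apply/perpPr=> t tC.
    by have := zw t tC; rewrite (polarDl quadQ) (isow y t) // addr0.
  have := uniserial minp Pu (capvSl _ _) (sub_perp _ w (@stable_cyc phi u)) R0.
  by case/memv_capP=> _ /perpPr/(_ w (mem_cyc _ _))/eqP; rewrite (negPf fuw).
have y0 : y = 0.
  have [R0|R0] := eqVneq (cyc phi w :&: perp quadQ (cyc phi u))%VS 0%VS.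
    apply/eqP; rewrite -memv0 -R0 memv_cap yC; apply/perpPr=> t tC.
    by have := zu t tC; rewrite (polarDl quadQ) x0 (polar0l quadQ) add0r.
  have sV : stable (cyc phi w :&: perp quadQ (cyc phi u)) phiV.
    by apply: stable_inv; [apply: isom_ker iphi | apply/sub_perp/stable_cyc].
  have := uniserial minp' Pw _ sV R0; rewrite eqw capvSl => /(_ isT).
  case/memv_capP=> _ /perpPr/(_ u (mem_cyc _ _))/eqP.
  by rewrite polarC (negPf fuw').
by rewrite x0 y0 addr0.
Qed.

(** The adjoint of [N] is [- phi^-1 N], and [phi] fixes [N^k v], so each factor contributes a
    sign. *)
Lemma unipotent_adj_top k v w : iter k.+1 N v = 0 ->
  f (iter k N w) v = (-1) ^+ k * f (iter k N v) w.
Proof.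
move=> Nv; rewrite (adj_iter_sub1 quadQ ndefQ) //; set x := iter k N v.
have phix : (- phiV : 'End(V)) x = - x.
  have /eqP : N x = 0 by [].
  by rewrite sub1E subr_eq0 => /eqP E; rewrite opp_lfunE -{1}E phiK.
suff -> : iter k (- phiV : 'End(V)) x = (-1) ^+ k *: x.
  by rewrite (polarZr quadQ) polarC.
elim: (k) => [|i /= ->]; first by rewrite expr0 scale1r.
by rewrite linearZ /= phix exprS mulN1r scalerN scaleNr.
Qed.

(* In [H = cyc v + cyc w] every radical vector is [N^j h] for all [j], by
   pairing [N^(k-j) z] with [v] and [w] to kill the leading coefficients. *)
Lemma unipotent_pair_nondeg k v w :
  iter k.+1 N v = 0 -> iter k.+1 N w = 0 ->
  f (iter k N v) w != 0 -> f (iter k N v) v = 0 ->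
  nondeg quadQ (cyc phi v + cyc phi w).
Proof.
move=> Nv Nw fvw fvv; set H := (_ + _)%VS.
have sH : stable H phi by apply: stable_add; apply: stable_cyc.
have sN U1 : stable U1 phi -> stable U1 N.
  by move=> sU x xU; rewrite sub1E memvB ?sU.
have cycN u x : x \in cyc phi u -> exists a t, t \in cyc phi u /\ x = a *: u + N t.
  move: x; apply: cyc_ind => [|x y [a [t [tC ->]]] [b [s [sC ->]]]|a|x [a [t [tC ->]]]].
  - by exists 0, 0; rewrite mem0v scale0r linear0 addr0.
  - exists (a + b), (t + s); rewrite memvD //; split=> //.
    by rewrite scalerDl linearD /= addrACA.
  - by exists a, 0; rewrite mem0v linear0 addr0.
  exists a, (a *: u + N t + t); split.
    by rewrite !memvD ?memvZ ?mem_cyc // sN //; apply: stable_cyc.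
  rewrite [N (_ + t)]linearD /=; set x' := a *: u + N t.
  by rewrite [N x']sub1E addrC -addrA [N t + _]addrC -/x' subrK.
have NH h : h \in H -> iter k.+1 N h = 0.
  have Nphi i x : iter i N (phi x) = phi (iter i N x).
    by rewrite iter_comm // => t; rewrite !sub1E linearB.
  rewrite /H -cyc_addW; move: h; apply: cycs_ind => [|x y Nx Ny|x|x Nx].
  - exact: iter0_lin.
  - by rewrite iterD_lin Nx Ny addr0.
  - case/memv_addP=> _ /vlineP[a ->] [_ /vlineP[b ->] ->].
    by rewrite iterD_lin !iterZ_lin Nv Nw !scaler0 addr0.
  - by rewrite Nphi Nx linear0.
have sp : stable (perp quadQ H) phi by apply: perp_stable.
rewrite /nondeg -subv0; apply/subvP=> z.
rewrite memv_cap memv0 => /andP[zH zp].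
suff /(_ k.+1 (leqnn _)) [h [hH ->]] : forall j, (j <= k.+1)%N ->
    exists h, h \in H /\ z = iter j N h by rewrite NH.
elim=> [_|j IH ltj]; first by exists z.
have [h [hH zE]] := IH (ltnW ltj).
case/memv_addP: hH => x /cycN[a [t [tC ->]]] [y /cycN[b [s [sC ->]]] hE].
have tsH : t + s \in H by rewrite memv_add.
have NhE : iter (k - j) N z = a *: iter k N v + b *: iter k N w.
  rewrite zE -iterD subnK // hE addrACA iterD_lin -linearD /= -iterSr NH // addr0.
  by rewrite iterD_lin !iterZ_lin.
have Np : iter (k - j) N z \in perp quadQ H by apply: iter_stable zp; apply: sN.
have vH : v \in H by rewrite (subvP (addvSl _ _)) ?mem_cyc.
have wH : w \in H by rewrite (subvP (addvSr _ _)) ?mem_cyc.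
have fwv : f (iter k N w) v != 0.
  by rewrite unipotent_adj_top // mulf_neq0 // signr_eq0.
move/perpPr: Np => Np; rewrite NhE in Np.
have b0 : b = 0.
  have := Np v vH; rewrite (polarDl quadQ) !(polarZl quadQ) fvv mulr0 add0r.
  by move/eqP; rewrite mulf_eq0 (negPf fwv) orbF => /eqP.
have a0 : a = 0.
  have := Np w wH; rewrite (polarDl quadQ) !(polarZl quadQ) b0 mul0r addr0.
  by move/eqP; rewrite mulf_eq0 (negPf fvw) orbF => /eqP.
exists (t + s); split=> //.
by rewrite zE hE a0 b0 !scale0r !add0r -linearD iterSr.
Qed.

End NondegenerateSpan.

(** * Bicyclic unipotent summands and the subalgebra generated by [phi + phi^-1] *)

Section ReversingSummand.
Variables (K : fieldType) (V : vectType K) (Q : V -> K).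
Hypotheses (quadQ : quadratic_form Q) (ndefQ : nondefective Q).
Variable (phi : 'End(V)).
Hypothesis iphi : isometry_of Q phi.
Local Notation f := (polar Q).
Local Notation phiV := (phi^-1)%VF.
Local Notation N := (phi - \1%VF).
Implicit Types (u v w x y z : V) (U H : {vspace V}).

Let phiK : cancel phi phiV := isomKV quadQ ndefQ iphi.
Let phiVK : cancel phiV phi := isomVK quadQ ndefQ iphi.

Definition theta : 'End(V) := phi + phiV.
(* [theta - 2 = phi^-1 (phi - 1)^2] generates the same subspaces as [theta] and
   raises the filtration by the powers of [phi - 1] by 2. *)
Definition theta2 : 'End(V) := (phiV \o N \o N)%VF.

Lemma theta2E x : theta2 x = phi x + phiV x - x *+ 2.
Proof.
rewrite !comp_lfunE [N (N x)]sub1E [N x]sub1E linearB /= phiK linearB /= phiK.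
by rewrite opprB addrACA -opprD mulr2n.
Qed.

Lemma phi_N x : phi (N x) = N (phi x).
Proof. by rewrite !sub1E linearB. Qed.

Lemma phiV_N x : phiV (N x) = N (phiV x).
Proof. by rewrite !sub1E linearB /= phiK phiVK. Qed.

Lemma N_theta2 x : N (theta2 x) = theta2 (N x).
Proof. by rewrite !comp_lfunE -phiV_N. Qed.

Lemma phi_theta2 x : phi (theta2 x) = theta2 (phi x).
Proof. by rewrite !comp_lfunE -!phi_N phiK phiVK. Qed.

Lemma theta_theta2_stable U x : stable U theta2 -> x \in U -> theta x \in U.
Proof.
move=> sU xU; have -> : theta x = theta2 x + x *+ 2.
  by rewrite theta2E subrK add_lfunE.
by rewrite memvD ?sU // rpredMn.
Qed.

Lemma phi_iterV i x : phi (iter i phiV x) = iter i phiV (phi x).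
Proof. by rewrite iter_comm // => y; rewrite phiK phiVK. Qed.

Lemma phiV_iterV i x : phiV (iter i phiV x) = iter i phiV (phiV x).
Proof. by rewrite iter_comm. Qed.

(** The sequence [s_i = phi^i x + phi^-i y] satisfies [s_(i+2) = theta s_(i+1) - s_i]. *)
Lemma reciprocal_mem U x y : stable U theta2 -> x + y \in U ->
  phi x + phiV y \in U -> forall i, iter i phi x + iter i phiV y \in U.
Proof.
move=> sU xy0 xy1 i.
suff [] : iter i phi x + iter i phiV y \in U /\
          iter i.+1 phi x + iter i.+1 phiV y \in U by [].
elim: i => // i [S0 S1]; split=> //.
have -> : iter i.+2 phi x + iter i.+2 phiV y =
   theta (iter i.+1 phi x + iter i.+1 phiV y) - (iter i phi x + iter i phiV y).
  rewrite add_lfunE !linearD /= phiK phiVK [iter i phi x + phiV _]addrC.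
  by rewrite -opprD addrACA [iter i phiV y + _]addrC addrK.
by rewrite memvB // theta_theta2_stable.
Qed.

Lemma cyc_theta2_iter_eq0 j u y :
  y \in cyc theta2 u -> iter j N u = 0 -> iter j N y = 0.
Proof.
move=> yC Nu; move: y yC; apply: cyc_ind => [|x y Nx Ny|a|x Nx].
- exact: iter0_lin.
- by rewrite iterD_lin Nx Ny addr0.
- by rewrite iterZ_lin Nu scaler0.
- by rewrite -iter_comm ?Nx ?linear0 // => y; rewrite N_theta2.
Qed.

Lemma phi_fixed x : N x = 0 -> phi x = x.
Proof. by move/eqP; rewrite sub1E subr_eq0 => /eqP. Qed.

(** Applying [N^(k-e)] isolates the coefficient of [N^e v]: everything else dies by
    [N^(k+1) v = 0]. *)
Lemma theta2_valuation_step d k e v : k = (e + d.*2.+1)%N ->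
  iter k.+1 N v = 0 -> iter k N v != 0 -> iter k N v \in cyc theta2 (iter e N v) ->
  iter k N v \in cyc theta2 (phiV (iter e.+2 N v)).
Proof.
move=> ke Nk Nk0 /cyc_recP[a [y [yC yE]]].
have lt_ek : (e < k)%N by rewrite ke addnS ltnS leq_addr.
have thE : theta2 (iter e N v) = phiV (iter e.+2 N v) by rewrite !comp_lfunE.
rewrite thE in yC; suff a0 : a = 0 by rewrite {1}yE a0 scale0r add0r.
have Ny : iter (k - e) N y = 0.
  apply: cyc_theta2_iter_eq0 yC _.
  rewrite -iter_comm; last by move=> z; rewrite phiV_N.
  rewrite -iterD (iter_eq0_leq _ Nk) ?linear0 //.
  by rewrite !addnS ltnS ltnW // ltnS subnK // ltnW.
have := congr1 (iter (k - e) N) yE.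
rewrite iterD_lin Ny addr0 iterZ_lin -!iterD (subnK (ltnW lt_ek)).
rewrite (iter_eq0_leq _ Nk); last by rewrite -add1n leq_add2r subn_gt0.
by move/esym/eqP; rewrite scaler_eq0 (negPf Nk0) orbF => /eqP.
Qed.

(** A nonzero element of [K[theta2] N^e v] has a leading term at some height [e + 2i], whereas
    [k - e] is odd. *)
Lemma theta2_valuation d k e v : k = (e + d.*2.+1)%N ->
  iter k.+1 N v = 0 -> iter k N v != 0 ->
  iter k N v \notin cyc theta2 (iter e N v).
Proof.
move=> ke Nk Nk0; elim: d e ke => [|d IH] e ke; apply/negP => kC.
  have := theta2_valuation_step ke Nk Nk0 kC.
  move/(cyc_theta2_iter_eq0 (j := 0)); rewrite /= -iterS -iterS => kN.
  by case/eqP: Nk0; apply: kN; rewrite -[iter _ _ _]/(iter e.+2 N v) -addn2 addnS -ke Nk linear0.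
have ke2 : k = (e.+2 + d.*2.+1)%N by rewrite ke doubleS !addnS !addSn.
have /negP := IH e.+2 ke2; apply.
have phik : phi (iter k N v) = iter k N v by apply: phi_fixed.
rewrite -phik; have := memv_img phi (theta2_valuation_step ke Nk Nk0 kC).
by rewrite (@img_cyc _ _ _ phi theta2 theta2) ?phiVK // => x; rewrite phi_theta2.
Qed.

(* A bicyclic summand, spanned by [v] and [w] with
   [f v (a w) = - f v (a^* w)], or [f v (phi a w) = f v (a^* w)], for all
   polynomials [a] in [phi], where [a^*] is the adjoint of [a]. *)
Lemma bicyclic_inverter k v w :
  iter k.+1 N v = 0 -> iter k.+1 N w = 0 ->
  f (iter k N v) w != 0 -> f (iter k N v) v = 0 ->
  (if odd k then forall x, x \in cyc theta2 v -> f x w = 0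
   else forall x, x \in cyc theta2 (phiV (N v)) -> f x w = 0) ->
  exists2 sigma, inverter_on Q phi (cyc phi v + cyc phi w) sigma
    & sigma v = v /\ sigma w = if odd k then - w else phi w.
Proof.
move=> Nv Nw fvw fvv fY.
have nd : nondeg quadQ (cyc phi v + cyc phi w).
  exact: (unipotent_pair_nondeg quadQ ndefQ iphi Nv Nw fvw fvv).
have fself x i : f x (iter i phi x) = f x (iter i phiV x).
  by rewrite (iter_phiV_adj quadQ ndefQ iphi) polarC.
have sC u : stable (cyc theta2 u) theta2 by apply: stable_cyc.
have swap_w u : (u, w) \in cyc (graph_step phi) (w, u) ->
    (u, w) \in (cyc (graph_step phi) (v, v) + cyc (graph_step phi) (w, u))%VS.
  exact/subvP/addvSr.
have swap_v u : (v, v) \in (cyc (graph_step phi) (v, v) + cyc (graph_step phi) (w, u))%VS.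
  by rewrite (subvP (addvSl _ _)) ?mem_cyc.
have adjV := iter_phiV_adj quadQ ndefQ iphi.
have adj := iter_phi_adj quadQ ndefQ iphi.
case: (odd k) fY => fY.
- have fC i : f v (iter i phi w) = - f v (iter i phiV w).
    apply/eqP; rewrite -addr_eq0 adjV adj -(polarDl quadQ) addrC.
    apply/eqP/fY/reciprocal_mem => //=; first by rewrite memvD ?mem_cyc.
    have -> : phi v + phiV v = theta v by rewrite add_lfunE.
    by rewrite theta_theta2_stable ?mem_cyc.
  apply: pair_inverter => //.
  - by rewrite (quadN quadQ).
  - by move=> i; rewrite iterN_lin (polarNr quadQ).
  - move=> i; rewrite (polarNl quadQ) adjV adj polarC [f (iter i phi w) v]polarC.
    by rewrite fC opprK.
  - by move=> i; rewrite iterN_lin (polarNl quadQ) (polarNr quadQ) opprK.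
  - apply: swap_w; have -> : (- w, w) = - (w, - w) :> V * V by congr pair; rewrite opprK.
    by rewrite memvN mem_cyc.
(* Sending [w] to [w] would require [w] to be orthogonal to [K[theta] (phi - phi^-1) v]. In
   characteristic 2 this contains [N^k v = theta2^(k/2) v] for even [k > 0]. With [phi w] the
   generator becomes [v - phi^-1 v = phi^-1 N v], of height 1 in every characteristic. *)
have Y0 : v - phiV v \in cyc theta2 (phiV (N v)).
  by rewrite -[X in X - _]phiK -linearB -sub1E mem_cyc.
apply: pair_inverter => //.
- move=> i; rewrite adj -phi_iterV -(isom_adjV quadQ ndefQ _ _ iphi) adjV.
  apply/eqP; rewrite -subr_eq0 -(polarBl quadQ) addrC -iterN_lin.
  apply/eqP/fY/reciprocal_mem => //=; first by rewrite addrC.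
  by rewrite linearN /= phiVK addrC -opprB memvN.
- move=> i; rewrite polarC [f (phi w) _]polarC -(isom_adjV quadQ ndefQ _ _ iphi).
  apply/eqP; rewrite -subr_eq0 -(polarBl quadQ) phiV_iterV -iterN_lin.
  apply/eqP/fY/reciprocal_mem => //=.
  have -> : phi v + phiV (- phiV v) = theta (v - phiV v) + (v - phiV v).
    rewrite add_lfunE !linearB /= phiVK linearN /=.
    by rewrite [RHS]addrAC !addrA !subrK.
  by rewrite memvD // theta_theta2_stable.
- move=> i; rewrite -phi_iterV (isomP iphi); exact: fself.
- apply: swap_w; have -> : (phi w, w) = graph_step phi (w, phi w).
    by rewrite graph_stepE /= phiK.
  by apply: cycs_stable; apply: mem_cyc.
Qed.

End ReversingSummand.

(** * Existence of inverting involutions *)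

Lemma exists_minimal (T : Type) (m : T -> nat) (P : T -> Prop) :
  (exists x, P x) -> exists x, P x /\ forall y, P y -> (m x <= m y)%N.
Proof.
case=> x; have [n] := ubnP (m x); elim: n x => // n IH x lt_xn Px.
have [[y [Py lt_yx]]|no] := classic (exists y, P y /\ (m y < m x)%N).
  by apply: (IH y) => //; apply: leq_trans lt_yx _; rewrite -ltnS.
exists x; split=> // y Py; rewrite leqNgt; apply/negP=> lt_yx.
by apply: no; exists y.
Qed.

Section Existence.
Variables (K : fieldType) (V : vectType K) (Q : V -> K).
Hypotheses (quadQ : quadratic_form Q) (ndefQ : nondefective Q).
Local Notation f := (polar Q).
Implicit Types (u v w x y z : V) (U H : {vspace V}) (g phi : 'End(V)).

Lemma exists_annihilator g x : exists2 p, p != 0 & pact g p x = 0.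
Proof.
pose n := (dim V).+1.
pose F (a : 'rV[K]_n) : V := \sum_i a 0 i *: iter i g x.
have linF : linear F.
  move=> k a b; rewrite scaler_sumr -big_split; apply: eq_bigr => i _.
  by rewrite !mxE scalerDl scalerA.
have : lker (lmap linF) != 0%VS.
  rewrite -dimv_eq0 -lt0n.
  have := limg_ker_dim (lmap linF) fullv; rewrite capfv dimvf dim_matrix mul1r => dE.
  have := dimvS (subvf (limg (lmap linF))); rewrite dimvf => le.
  by rewrite -(ltn_add2r (\dim (limg (lmap linF)))) dE add0n ltnS.
rewrite -vpick0; have := memv_pick (lker (lmap linF)).
set a := vpick _; rewrite memv_ker lmapE => /eqP Fa a0.
exists (\poly_(i < n) a 0 (inord i)).
  apply: contraNneq a0 => /polyP p0; apply/eqP/rowP=> i.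
  by have := p0 i; rewrite coef_poly ltn_ord coef0 inord_val mxE.
rewrite (pactE _ _ (size_poly _ _)) -[RHS]Fa; apply: eq_bigr => i _.
by rewrite coef_poly ltn_ord inord_val.
Qed.

Lemma exists_minimal_kernel g : (exists x : V, x != 0) ->
  exists p, minimal_kernel g p /\ exists2 x, x != 0 & pact g p x = 0.
Proof.
case=> x x0; have [p0 p0n p0x] := exists_annihilator g x.
have [|p [[p_n0 [y y0 py]] minp]] := @exists_minimal _ (fun p : {poly K} => size p)
  (fun p => p != 0 /\ exists2 y, y != 0 & pact g p y = 0).
  by exists p0; split=> //; exists x.
exists p; split; last by exists y.
split=> // r z r0 lt_r rz; apply/eqP/negPn/negP=> z0.
by have := minp r (conj r0 (ex_intro2 _ _ z z0 rz)); rewrite leqNgt lt_r.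
Qed.

(** [k + 1] is the nilpotency index of [g] on its generalized kernel, at least 1 since [g] is
    singular. *)
Lemma exists_nilpotency g : (exists2 x, x != 0 & g x = 0) ->
  exists k, (forall x, iter (dim V) g x = 0 -> iter k.+1 g x = 0) /\
    exists2 v, iter (dim V) g v = 0 & iter k g v != 0.
Proof.
case=> x x0 gx; set n := dim V.
have ex : exists k, (lker (lexp g n) <= lker (lexp g k))%VS by exists n.
have n_gt0 : (0 < n)%N.
  by rewrite -[n]dimvf lt0n dimv_eq0; apply: contraNneq x0 => E; rewrite -memv0 -E memvf.
have xK : x \in lker (lexp g n).
  by rewrite mem_lker_lexp (iter_eq0_leq n_gt0).
case: (ex_minnP ex) => -[|k] kP kmin.
  by have := subvP kP _ xK; rewrite mem_lker_lexp (negPf x0).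
exists k; split=> [y|].
  by move/eqP; rewrite -mem_lker_lexp => /(subvP kP); rewrite mem_lker_lexp => /eqP.
have : ~~ (lker (lexp g n) <= lker (lexp g k))%VS.
  by apply/negP=> /kmin; rewrite ltnn.
by case/subvPn=> v; rewrite !mem_lker_lexp => /eqP gv gv0; exists v.
Qed.

Definition reversing_summand phi H := [/\ H != 0%VS, nondeg quadQ H, stable H phi
  & exists sigma, inverter_on Q phi H sigma].

Section Isometry.
Variable phi : 'End(V).
Hypothesis iphi : isometry_of Q phi.
Local Notation phiV := (phi^-1)%VF.
Local Notation N := (phi - \1%VF).

Let phiK : cancel phi phiV := isomKV quadQ ndefQ iphi.
Let phiVK : cancel phiV phi := isomVK quadQ ndefQ iphi.

Lemma cyc_neq0 g v : v != 0 -> cyc g v != 0%VS.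
Proof. by apply: contraNneq => E; rewrite -memv0 -E mem_cyc. Qed.

Lemma iter_neq0 g k v : iter k g v != 0 -> v != 0.
Proof. by apply: contraNneq => ->; rewrite iter0_lin. Qed.

Lemma cyc_summand v : v != 0 -> nondeg quadQ (cyc phi v) ->
  reversing_summand phi (cyc phi v).
Proof.
move=> v0 nd; split=> //; [exact: cyc_neq0 | exact: stable_cyc |].
by have [sigma sP _] := cyc_inverter ndefQ iphi nd; exists sigma.
Qed.

Lemma iter_pactXsub1 i x : iter i (pact phi ('X - 1%:P)) x = iter i N x.
Proof. by elim: i => //= i ->; rewrite pactXsub1. Qed.

Lemma unipotent_cyc_nondeg k v : iter k.+1 N v = 0 -> f (iter k N v) v != 0 ->
  nondeg quadQ (cyc phi v).
Proof.
move=> Nv fv.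
apply: (@cyc_nondeg _ _ _ quadQ ndefQ phi iphi ('X - 1%:P) k v _ _ _ _ fv).
- exact: minimal_kernel_sub1.
- by rewrite iter_pactXsub1.
- by rewrite iter_pactXsub1 mem_cyc.
Qed.

(** Chains of maximal length are used. If some vector pairs with its own top, it generates a cyclic
    summand; otherwise [v] needs a partner [w] that satisfies the conditions of
    [bicyclic_inverter]. *)
Lemma exists_fixed_summand : (exists2 x, x != 0 & phi x = x) ->
  exists H, reversing_summand phi H.
Proof.
case=> x x0 phix; set n := dim V.
have Nx : exists2 x, x != 0 & N x = 0 by exists x => //; rewrite sub1E phix subrr.
have [k [Nk [v Nv Nv0]]] := exists_nilpotency Nx.
have [[u [Nu fu]]|alt] := classic (exists u, iter n N u = 0 /\ f (iter k N u) u != 0).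
  exists (cyc phi u); apply: cyc_summand; last exact: unipotent_cyc_nondeg (Nk u Nu) fu.
  by apply: contraNneq fu => ->; rewrite (polar0r quadQ).
have fvv : f (iter k N v) v = 0.
  by apply/eqP/negPn/negP => fvv; apply: alt; exists v.
(* The height of [y] has the parity opposite to [k], which keeps the top [N^k v] out of [K[theta]
   y]. *)
pose y := if odd k then v else phiV (N v).
have Y_notin : iter k N v \notin cyc (theta2 phi) y.
  rewrite /y; case: ifPn => oddk.
    apply: (@theta2_valuation _ _ _ quadQ ndefQ _ iphi k./2 k 0) (Nk v Nv) Nv0.
    by rewrite add0n -{1}(odd_double_half k) oddk.
  apply/negP=> kY.
  have k_gt0 : (0 < k)%N -> iter k N v \notin cyc (theta2 phi) (iter 1 N v).
    have := odd_double_half k; rewrite (negPf oddk) add0n => kE.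
    case Eh: k./2 kE => [|h] kE; first by rewrite -kE.
    move=> _; apply: (@theta2_valuation _ _ _ quadQ ndefQ _ iphi h k 1) (Nk v Nv) Nv0.
    by rewrite -kE doubleS.
  have [k0|/k_gt0/negP] := posnP k.
    move: kY Nv0 (Nk v Nv); rewrite k0 /= => kY v0 Nv1.
    have st0 : stable (0 : {vspace V}) (theta2 phi).
      by move=> z; rewrite !memv0 => /eqP->; rewrite linear0.
    case/eqP: v0; apply/eqP; rewrite -memv0.
    by apply: (subvP (cyc_min _ st0)) kY; rewrite Nv1 linear0 mem0v.
  apply; have := memv_img phi kY.
  rewrite (@img_cyc _ _ _ phi (theta2 phi) (theta2 phi)) ?phiVK; last first.
    by move=> z; rewrite (phi_theta2 quadQ ndefQ iphi).
  by rewrite phi_fixed // -iterS Nk.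
have sub_ker : (cyc (theta2 phi) y <= lker (lexp N n))%VS.
  have yK : y \in lker (lexp N n).
    rewrite mem_lker_lexp /y; case: odd; first by rewrite Nv.
    rewrite -iter_comm; last by move=> z; rewrite (phiV_N quadQ ndefQ iphi).
    by rewrite -iterSr iterS Nv !linear0.
  apply: cyc_min => // z; rewrite !mem_lker_lexp => /eqP Nz.
  rewrite -iter_comm ?Nz ?linear0 // => t; exact: esym (N_theta2 quadQ ndefQ iphi t).
(* Orthogonality to [limg (lexp N n)] will place [w] in the generalized eigenspace, so that
   [N^(k+1) w = 0]. *)
have NvU : iter k N v \notin (cyc (theta2 phi) y + limg (lexp N n))%VS.
  apply: contra Y_notin => /memv_addP[a aY [b bI NvE]].
  suff b0 : b = 0 by rewrite NvE b0 addr0.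
  apply/eqP; rewrite -memv0 -(fitting_cap N) memv_cap bI andbT.
  have -> : b = iter k N v - a by rewrite NvE addrC addKr.
  apply: memvB; last exact: subvP sub_ker _ aY.
  by rewrite mem_lker_lexp -iterD addnC iterD Nv iter0_lin.
have [w] := exists_perp_notin quadQ ndefQ NvU.
rewrite perpD memv_cap perp_limg_iter // => /andP[/perpP wY wK] fw.
have Nw : iter n N w = 0 by apply/eqP; rewrite -mem_lker_lexp.
have [|sigma sP _] := bicyclic_inverter quadQ ndefQ iphi (Nk v Nv) (Nk w Nw) fw fvv.
  by move: wY; rewrite /y; case: odd.
exists (cyc phi v + cyc phi w)%VS; split.
- rewrite -dimv_eq0 -lt0n (leq_trans _ (dimvS (addvSl _ _))) // lt0n dimv_eq0.
  by rewrite cyc_neq0 // (iter_neq0 Nv0).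
- exact: (unipotent_pair_nondeg quadQ ndefQ iphi (Nk v Nv) (Nk w Nw) fw fvv).
- by apply: stable_add; apply: stable_cyc.
- by exists sigma.
Qed.

(** * Summands when neither 1 nor -1 is an eigenvalue *)

Lemma iter_phi_phiV e i x : (i <= e)%N ->
  iter e phi (iter i phiV x) = iter (e - i) phi x.
Proof.
elim: i x => [|i IH] x lt_ie; first by rewrite subn0.
by rewrite iterSr IH 1?ltnW // -{1}(prednK (n := e - i)) ?subn_gt0 // iterSr phiVK subnS.
Qed.

(** The reciprocal polynomial [x^deg(r) r(1/x)]; its degree drops when [r] vanishes at 0. *)
Definition rev_poly (r : {poly K}) := \poly_(i < size r) r`_((size r).-1 - i).

Lemma pact_rev_poly (r : {poly K}) x :
  iter (size r).-1 phi (pact phiV r x) = pact phi (rev_poly r) x.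
Proof.
rewrite (pactE _ _ (size_poly _ _)) (pactE _ _ (leqnn _)) -lexpE linear_sum.
rewrite [RHS](reindex_inj rev_ord_inj) /=; apply: eq_bigr => i _.
have lt_i := ltn_ord i; have s_gt0 : (0 < size r)%N by apply: leq_ltn_trans lt_i.
have le_i : (i <= (size r).-1)%N by rewrite -ltnS prednK.
rewrite linearZ /= lexpE iter_phi_phiV // coef_poly ltn_subrL s_gt0 /=.
have -> : (size r - i.+1 = (size r).-1 - i)%N by rewrite -subn1 -subnDA add1n.
by rewrite subKn.
Qed.

Lemma rev_poly_neq0 (r : {poly K}) : r != 0 -> rev_poly r != 0.
Proof.
move=> r0; apply/eqP=> /polyP/(_ 0%N).
rewrite coef_poly coef0 lt0n size_poly_eq0 r0 subn0 => /eqP.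
by rewrite -lead_coefE lead_coef_eq0 (negPf r0).
Qed.

Lemma iter_phi_eq0 e x : iter e phi x = 0 -> x = 0.
Proof.
by elim: e => //= e IH E; apply: IH; rewrite -[LHS]phiK E linear0.
Qed.

Lemma minimal_kernel_inv p : minimal_kernel phi p -> minimal_kernel phiV p.
Proof.
move=> [p0 minp]; split=> // r x r0 lt_r rx.
apply: minp (rev_poly_neq0 r0) (leq_ltn_trans (size_poly _ _) lt_r) _.
by rewrite -pact_rev_poly rx iter0_lin.
Qed.

Lemma pact_adj p x y : f (pact phi p x) y = f x (pact phiV p y).
Proof.
rewrite !(pactE _ _ (leqnn _)) (polar_suml quadQ) (polar_sumr quadQ).
apply: eq_bigr => i _; rewrite (polarZl quadQ) (polarZr quadQ).
by rewrite (iter_phiV_adj quadQ ndefQ iphi).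
Qed.

(** In characteristic 2 an isotropic [U] need not be singular for [Q]. Without fixed vectors [N]
    maps [U] onto itself, and [Q (N y) = 2 Q y - f (phi y) y = f y y - f (phi y) y] vanishes. *)
Lemma isotropic_nofix_singular U : (forall x, phi x = x -> x = 0) ->
  stable U phi -> (forall x y, x \in U -> y \in U -> f x y = 0) ->
  forall x, x \in U -> Q x = 0.
Proof.
move=> fix1 sU isoU.
have NU : (N @: U == U)%VS.
  have kU : (U :&: lker N = 0)%VS.
    apply/eqP; rewrite -subv0; apply/subvP=> x; rewrite memv_cap memv_ker memv0.
    by case/andP=> _ /eqP/phi_fixed/fix1->.
  rewrite eqEdim (limg_dim_eq kU) leqnn andbT.
  by apply/subvP=> _ /memv_imgP[x xU ->]; rewrite sub1E memvB ?sU.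
move=> x; rewrite -{1}(eqP NU) => /memv_imgP[y yU ->].
rewrite sub1E (quadB quadQ) iphi isoU ?sU // subr0 -mulr2n -(polarxx quadQ).
exact: isoU.
Qed.

Section NoFixedVector.
Hypotheses (fix1 : forall x, phi x = x -> x = 0).
Hypotheses (fixN1 : forall x, phi x = - x -> x = 0).
Variable p : {poly K}.
Hypothesis minp : minimal_kernel phi p.
Hypothesis kerp : exists2 x, x != 0 & pact phi p x = 0.
Local Notation P := (pact phi p).
Local Notation P' := (pact phiV p).
Local Notation n := (dim V).

Let adjP i x y : f (iter i P x) y = f x (iter i P' y).
Proof. by apply: adj_iter => u v; rewrite pact_adj. Qed.

Let comm_phi_P x : phi (P x) = P (phi x). Proof. exact: pact_comm. Qed.
Let comm_phi_P' x : phi (P' x) = P' (phi x).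
Proof. by apply: pact_comm => y; rewrite phiK phiVK. Qed.
Let comm_P_P' x : P (P' x) = P' (P x).
Proof. by apply: pact_comm => y; rewrite pact_comm // => z; rewrite phiK phiVK. Qed.

Let perp_imP : perp quadQ (limg (lexp P n)) = lker (lexp P' n).
Proof. by apply: perp_limg_adj => // x y; rewrite !lexpE adjP. Qed.

Let perp_imP' : perp quadQ (limg (lexp P' n)) = lker (lexp P n).
Proof. by apply: perp_limg_adj => // x y; rewrite !lexpE polarC -adjP polarC. Qed.

(* If [p(phi^-1)] vanishes on [ker p(phi)], some cyclic submodule of the
   [p]-primary component is nondegenerate: otherwise [phi^2] would have a fixed
   vector. *)
Lemma self_dual_summand : (forall x, P x = 0 -> P' x = 0) ->
  exists H, reversing_summand phi H.
Proof.
move=> kerP1.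
have kerPP' i x : iter i P x = 0 -> iter i P' x = 0.
  elim: i x => // i IH x Px; rewrite iterSr IH //.
  rewrite -(iter_comm (f := P')) ?kerP1 // => y; exact: esym (comm_P_P' y).
have [k [Pk [v Pv Pv0]]] := exists_nilpotency kerp.
have eqK : lker (lexp P' n) = lker (lexp P n).
  apply/eqP; rewrite eq_sym eqEdim; apply/andP; split.
    by apply/subvP=> x; rewrite !mem_lker_lexp => /eqP/kerPP' ->.
  rewrite -perp_imP -(leq_add2r (\dim (limg (lexp P n)))) dim_perp //.
  by rewrite dim_ker_limg.
have ndK x : iter n P x = 0 -> (forall w, iter n P w = 0 -> f x w = 0) -> x = 0.
  move=> Px fx; apply/eqP; rewrite -memv0 -(fitting_cap P) memv_cap.
  rewrite mem_lker_lexp Px eqxx /= -[limg _](perpK quadQ ndefQ) perp_imP eqK.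
  by apply/perpPr=> w; rewrite mem_lker_lexp => /eqP; apply: fx.
have [[u [i [Pu fu]]]|alt] := classic (exists u i,
    iter n P u = 0 /\ f (iter i phi (iter k P u)) u != 0).
  exists (cyc phi u); apply: cyc_summand.
    by apply: contraNneq fu => ->; rewrite (polar0r quadQ).
  apply: (@cyc_nondeg _ _ _ quadQ ndefQ phi iphi p k u _ minp (Pk u Pu) _ fu).
  by apply: iter_stable (mem_cyc _ _) => x; apply: cycs_stable.
have fv u i : iter n P u = 0 -> f (iter i phi (iter k P u)) u = 0.
  by move=> Pu; apply/eqP/negPn/negP=> fu; apply: alt; exists u, i.
(* Polarizing [fv] at [v + w] shows that the sum of both sides is orthogonal to the whole primary
   component. The cases [i = 0] and [i = 1] then give [phi y = phi^-1 y]. *)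
have skew i : iter i phi (iter k P v) = - iter i phiV (iter k P' v).
  apply/eqP; rewrite -addr_eq0; apply/eqP/ndK => [|w Pw].
    have commV x : P (phiV x) = phiV (P x).
      by apply: esym; apply: pact_comm => y; rewrite phiK phiVK.
    rewrite iterD_lin (iter_comm2 (f := P) (g := phi)) //.
    rewrite (iter_comm2 (f := P) (g := phiV)) // (iter_comm2 (f := P) (g := P')) //.
    by rewrite -iterD addnC iterD Pv !iter0_lin addr0.
  have Pvw : iter n P (v + w) = 0 by rewrite iterD_lin Pv Pw addr0.
  have := fv _ i Pvw; rewrite !iterD_lin !(polarDl quadQ) !(polarDr quadQ) !fv //.
  rewrite add0r addr0 => E; rewrite -[RHS]E; congr (_ + _).
  rewrite polarC (iter_phiV_adj quadQ ndefQ iphi) -adjP.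
  congr (f _ _); rewrite -(iter_comm2 (f := P)) // => x; exact: esym (comm_phi_P x).
set y := iter k P v in Pv0 skew.
have yy : phi (phi y) = y.
  have s0 : iter k P' v = - y by rewrite [y](skew 0%N) opprK.
  by have := skew 1%N; rewrite /= s0 linearN opprK => ->; rewrite phiVK.
case/eqP: Pv0; apply: fix1; apply/eqP; rewrite -subr_eq0; apply/eqP/fixN1.
by rewrite linearB /= yy opprB.
Qed.

(* If [p(phi^-1)] is injective on [ker p(phi)], the [p]-primary component and
   its dual are totally singular, and the two halves of a hyperbolic summand
   are exchanged. *)
Lemma hyperbolic_summand : (forall x, P x = 0 -> P' x = 0 -> x = 0) ->
  exists H, reversing_summand phi H.
Proof.
move=> injP.
have [k [Pk [u Pu Pu0]]] := exists_nilpotency kerp.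
have stP U : stable U phi -> stable U P by move=> sU x; apply: pact_stable.
have stP' U : stable U phi -> stable U P'.
  move=> sU x; apply: pact_stable; apply: stable_inv => //; exact: isom_ker iphi.
pose W := lker (lexp P n); pose W' := lker (lexp P' n).
have sW : stable W phi.
  move=> x; rewrite !mem_lker_lexp => /eqP Px.
  by rewrite -iter_comm ?Px ?linear0 // => y; rewrite comm_phi_P.
have sW' : stable W' phi.
  move=> x; rewrite !mem_lker_lexp => /eqP Px.
  by rewrite -iter_comm ?Px ?linear0 // => y; rewrite comm_phi_P'.
have inj_lift (A B : 'End(V)) m x : (forall x, A (B x) = B (A x)) ->
    (forall x, A x = 0 -> B x = 0 -> x = 0) ->
    iter m A x = 0 -> B x = 0 -> x = 0.
  move=> AB inj; elim: m x => // m IH x; rewrite iterSr => Ax Bx.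
  by apply: inj => //; apply: IH Ax _; rewrite -AB Bx linear0.
have inj_iter (A B : 'End(V)) m x : (forall x, A (B x) = B (A x)) ->
    (forall x, A x = 0 -> B x = 0 -> x = 0) ->
    iter n A x = 0 -> iter m B x = 0 -> x = 0.
  move=> AB inj; elim: m => // m IH Ax; rewrite iterS => Bx; apply: IH => //.
  apply: (inj_lift A B n) => //.
  by rewrite (iter_comm2 (f := A) (g := B)) ?Ax ?iter0_lin.
have sub_limg (A B : 'End(V)) U : (forall x, x \in U -> iter n A x = 0) ->
    stable U B -> (forall x, A (B x) = B (A x)) ->
    (forall x, A x = 0 -> B x = 0 -> x = 0) -> (U <= limg (lexp B n))%VS.
  move=> AU sU AB inj; have kU : (U :&: lker (lexp B n) = 0)%VS.
    apply/eqP; rewrite -subv0; apply/subvP=> x.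
    rewrite memv_cap mem_lker_lexp memv0 => /andP[/AU Ax /eqP Bx].
    by apply/eqP; apply: (inj_iter A B n).
  have /eqP <- : (lexp B n @: U == U)%VS.
    rewrite eqEdim (limg_dim_eq kU) leqnn andbT.
    by apply/subvP=> _ /memv_imgP[x xU ->]; rewrite lexpE iter_stable.
  by rewrite limgS ?subvf.
have isoW x y : x \in W -> y \in W -> f x y = 0.
  move=> xW yW; have : y \in perp quadQ W.
    rewrite /W -perp_imP' perpK //; apply: (subvP (sub_limg P P' W _ _ _ _)) yW => //.
    - by move=> z; rewrite mem_lker_lexp => /eqP.
    - exact: stP'.
  by move/perpP; apply.
have isoW' x y : x \in W' -> y \in W' -> f x y = 0.
  move=> xW yW; have : y \in perp quadQ W'.
    rewrite /W' -perp_imP perpK //; apply: (subvP (sub_limg P' P W' _ _ _ _)) yW => //.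
    - by move=> z; rewrite mem_lker_lexp => /eqP.
    - exact: stP.
    - by move=> z *; apply: injP.
  by move/perpP; apply.
have PuN : iter k P u \notin limg (lexp P n).
  apply: contra Pu0 => PuI; rewrite -memv0 -(fitting_cap P) memv_cap PuI andbT.
  by rewrite mem_lker_lexp -iterD addnC iterD Pu iter0_lin.
have [w] := exists_perp_notin quadQ ndefQ PuN; rewrite perp_imP => wW' fw.
have uW : u \in W by rewrite mem_lker_lexp Pu.
(* [P'^(k+1) w] is orthogonal to [ker P^n], where [P^(k+1)] vanishes, so it lies in the image of
   [P'^n] as well as in its kernel. *)
have Pw : iter k.+1 P' w = 0.
  apply/eqP; rewrite -memv0 -(fitting_cap P') memv_cap; apply/andP; split.
    move: wW'; rewrite !mem_lker_lexp -iterD addnC iterD => /eqP->.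
    by rewrite iter0_lin.
  rewrite -[limg _](perpK quadQ ndefQ) perp_imP'; apply/perpP=> x.
  by rewrite mem_lker_lexp => /eqP Px; rewrite -adjP Pk // (polar0l quadQ).
have subW : (cyc phi u <= W)%VS by apply: cyc_min.
have subW' : (cyc phi w <= W')%VS by apply: cyc_min.
have nd : nondeg quadQ (cyc phi u + cyc phi w).
  apply: (isotropic_pair_nondeg quadQ ndefQ iphi minp (minimal_kernel_inv minp) _ _ (Pk u Pu) Pw fw).
  - by move=> x y xC yC; apply: isoW; apply: (subvP subW).
  - by move=> x y xC yC; apply: isoW'; apply: (subvP subW').
  - by rewrite -adjP.
have itW i x : x \in W -> iter i phi x \in W by apply: iter_stable.
have sV U : stable U phi -> stable U phiV.
  by move=> sU; apply: stable_inv => //; apply: isom_ker iphi.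
have itW' i x : x \in W' -> iter i phiV x \in W' by apply: iter_stable; apply: sV.
have QW := isotropic_nofix_singular fix1 sW isoW.
have QW' := isotropic_nofix_singular fix1 sW' isoW'.
exists (cyc phi u + cyc phi w)%VS; split=> //.
- rewrite -dimv_eq0 -lt0n (leq_trans _ (dimvS (addvSl _ _))) // lt0n dimv_eq0.
  by rewrite cyc_neq0 // (iter_neq0 Pu0).
- by apply: stable_add; apply: stable_cyc.
have [|||||||||sigma sP _] := @pair_inverter _ _ _ quadQ ndefQ phi iphi u w w u.
- by rewrite QW ?QW'.
- by rewrite QW' ?QW.
- by move=> i; rewrite isoW ?itW // isoW' ?itW'.
- by move=> i; rewrite (iter_phi_adj quadQ ndefQ iphi) polarC.
- by move=> i; rewrite (iter_phi_adj quadQ ndefQ iphi) polarC.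
- move=> i; rewrite isoW' ?isoW //; first by apply: iter_stable uW; apply: sV.
  exact: iter_stable wW'.
- by rewrite (subvP (addvSr _ _)) ?mem_cyc.
- by rewrite (subvP (addvSl _ _)) ?mem_cyc.
- exact: nd.
by exists sigma.
Qed.

(** Up to a power of [phi], [p(phi^-1)] acts on [ker p(phi)] as the remainder [r]. By minimality of
    [p] this is either zero or injective. *)
Lemma exists_nofix_summand : exists H, reversing_summand phi H.
Proof.
pose r := rev_poly p %% p.
have decP' x : iter (size p).-1 phi (P' x) =
    pact phi (rev_poly p %/ p) (P x) + pact phi r x.
  by rewrite pact_rev_poly -pactM -pactD -divp_eq.
have [r0|r0] := eqVneq r 0.
  apply: self_dual_summand => x Px; apply: (@iter_phi_eq0 (size p).-1).
  by rewrite decP' Px r0 pact0 linear0 addr0.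
apply: hyperbolic_summand => x Px P'x; have [p0 inj] := minp.
apply: inj r0 _ _; first by rewrite ltn_modp.
by have := decP' x; rewrite Px P'x linear0 add0r iter0_lin.
Qed.

End NoFixedVector.

End Isometry.
End Existence.

Section Reversing.
Variable K : fieldType.

Lemma inverter_on_opp (V : vectType K) (Q : V -> K) (phi sigma : 'End(V)) H :
  inverter_on Q (- phi) H sigma -> inverter_on Q phi H sigma.
Proof.
move=> [st inv rev iso]; split=> // x xH.
by rewrite -(rev x xH) !opp_lfunE !linearN /= opprK.
Qed.

Lemma exists_reversing_summand (V : vectType K) (Q : V -> K)
    (quadQ : quadratic_form Q) (ndefQ : nondefective Q) (phi : 'End(V)) :
  isometry_of Q phi -> (exists x : V, x != 0) ->
  exists H, reversing_summand quadQ phi H.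
Proof.
move=> iphi x0.
have [fix1|nofix1] := classic (exists2 x : V, x != 0 & phi x = x).
  exact: exists_fixed_summand.
have [[x xn phix]|nofixN1] := classic (exists2 x : V, x != 0 & phi x = - x).
  have [|H [H0 nH sH [sigma sP]]] :=
      @exists_fixed_summand _ _ _ quadQ ndefQ (- phi) (isom_opp quadQ iphi).
    by exists x => //; rewrite opp_lfunE phix opprK.
  exists H; split=> //; last by exists sigma; apply: inverter_on_opp.
  by move=> y /sH; rewrite opp_lfunE memvN.
have [p [minp kerp]] := exists_minimal_kernel phi x0.
apply: (exists_nofix_summand quadQ ndefQ iphi _ _ minp kerp) => x phix.
  by apply/eqP/negPn/negP=> xn; apply: nofix1; exists x.
by apply/eqP/negPn/negP=> xn; apply: nofixN1; exists x.
Qed.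

Lemma exists_inverter (V : vectType K) (Q : V -> K)
    (quadQ : quadratic_form Q) (ndefQ : nondefective Q) (phi : 'End(V)) :
  isometry_of Q phi -> exists sigma, inverter_on Q phi fullv sigma.
Proof.
have [n] := ubnP (dim V); elim: n V Q quadQ ndefQ phi => // n IH V Q quadQ ndefQ phi lt_n iphi.
have [d0|dV] := posnP (dim V).
  have V0 (x : V) : x = 0.
    apply/eqP; rewrite -memv0; suff <- : fullv = 0%VS :> {vspace V} by exact: memvf.
    by apply/eqP; rewrite -dimv_eq0 dimvf d0.
  by exists \1%VF; split=> x _; rewrite ?memvf // !id_lfunE ?[phi _]V0 // [x]V0.
have x0 : exists x : V, x != 0.
  by exists (vpick fullv); rewrite vpick0 -dimv_eq0 dimvf -lt0n.
have [H [H0 nH sH [s1 s1P]]] := exists_reversing_summand quadQ ndefQ iphi x0.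
have sH' : stable (perp quadQ H) phi by apply: perp_stable.
have [||s2 s2P] := IH _ _ (quad_restrP quadQ (perp quadQ H))
    (quad_restr_ndef (nondeg_perp ndefQ nH)) (restr (perp quadQ H) phi).
- rewrite dim_subvs -ltnS (leq_trans _ lt_n) // ltnS -(dim_perp quadQ ndefQ H).
  by rewrite -[X in (X < _)%N]addn0 ltn_add2l lt0n dimv_eq0.
- exact: isometry_restr.
have [sigma [sP _ _]] := glue_inverter ndefQ iphi nH sH s1P (transport_inverter sH' s2P).
by exists sigma.
Qed.

End Reversing.

(** * Summands inverted by involutions of both parities *)

Section Flexible.
Variables (K : fieldType) (V : vectType K) (Q : V -> K).
Hypotheses (quadQ : quadratic_form Q) (ndefQ : nondefective Q).
Variable phi : 'End(V).
Hypothesis iphi : isometry_of Q phi.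
Local Notation f := (polar Q).
Local Notation phiV := (phi^-1)%VF.
Local Notation N := (phi - \1%VF).
Implicit Types (u v w x y z : V) (U H : {vspace V}).

Let phiK : cancel phi phiV := isomKV quadQ ndefQ iphi.
Let phiVK : cancel phiV phi := isomVK quadQ ndefQ iphi.

(** By [parity_triangle] the last condition says that [s1] and [s2] have opposite parities. It
    involves only [s1 - s2], which is unaffected by a common extension to [V]. *)
Definition flexible_summand H := exists s1 s2,
  [/\ nondeg quadQ H, stable H phi, inverter_on Q phi H s1,
      inverter_on Q phi H s2 & odd (\dim ((s1 - s2) @: H))].

Lemma cyc_sub1 v : cyc phi v = cyc N v.
Proof.
apply/eqP; rewrite eqEsubv !cyc_min ?mem_cyc // => x xC.
  by rewrite sub1E memvB // stable_cyc.
have -> : phi x = N x + x by rewrite sub1E subrK.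
by rewrite memvD // stable_cyc.
Qed.

Lemma polar_top i j x y : iter (i + j).+1 N x = 0 ->
  f (iter i N y) (iter j N x) = (-1) ^+ i * f (iter (i + j) N x) y.
Proof.
by move=> Nx; rewrite (unipotent_adj_top quadQ ndefQ iphi) -?iterD.
Qed.

Lemma inverter_ker H s : inverter_on Q phi H s -> (H :&: lker s = 0)%VS.
Proof.
case=> [_ inv _ _]; apply/eqP; rewrite -subv0; apply/subvP=> x.
rewrite memv_cap memv_ker memv0 => /andP[xH /eqP sx].
by rewrite -(inv x xH) sx linear0.
Qed.

Lemma inverter_comp H s : stable H phi -> inverter_on Q phi H s ->
  inverter_on Q phi H (s \o phi)%VF.
Proof.
move=> sH [st inv rev iso]; split=> x xH; rewrite !comp_lfunE.
- by rewrite st ?sH.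
- by rewrite rev ?inv.
- by rewrite rev ?sH.
- by rewrite iso ?sH.
Qed.

Lemma inverter_opp H s : inverter_on Q phi H s -> inverter_on Q phi H (- s).
Proof.
move=> [st inv rev iso]; split=> x xH; rewrite !opp_lfunE ?linearN /= ?opprK.
- by rewrite memvN st.
- exact: inv.
- by rewrite rev.
- by rewrite (quadN quadQ) iso.
Qed.

Lemma polar_sub1 x : f x (N x) = - Q (N x).
Proof.
rewrite !sub1E (quadB quadQ) iphi (polarBr quadQ) (polarxx quadQ).
by rewrite polarC opprB mulr2n.
Qed.

(** [f x (N x) = - Q (N x)] turns [Q (N^m v)] into a nonzero pairing of [v] with its top, so
    [cyc phi v] is nondegenerate of dimension [2m]. There [s phi] and [s] differ by [s N], of rank
    [2m - 1]. *)
Lemma even_flexible m v : iter m.*2 N v = 0 -> Q (iter m N v) != 0 ->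
  exists H, flexible_summand H.
Proof.
case: m => [|m] Nv Qv; first by rewrite [v]Nv (quad0 quadQ) eqxx in Qv.
rewrite doubleS in Nv.
have fv : f (iter m.*2.+1 N v) v != 0.
  have := @polar_top m m.+1 v v; rewrite addnS addnn => /(_ Nv) E.
  have : f (iter m N v) (iter m.+1 N v) != 0.
    by rewrite iterS polar_sub1 oppr_eq0 -iterS.
  by rewrite E mulf_eq0 negb_or => /andP[].
have nd := unipotent_cyc_nondeg quadQ ndefQ iphi Nv fv.
have sH : stable (cyc phi v) phi by apply: stable_cyc.
have [s sP _] := cyc_inverter ndefQ iphi nd.
exists (cyc phi v), (s \o phi)%VF, s; split=> //; first exact: inverter_comp.
have -> : (s \o phi)%VF - s = (s \o N)%VF.
  by apply/lfunP=> x; rewrite add_lfunE opp_lfunE !comp_lfunE sub1E linearB.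
rewrite limg_comp limg_dim_eq; last first.
  apply/eqP; rewrite -subv0 -(inverter_ker sP) capvS //.
  by apply/subvP=> _ /memv_imgP[x xC ->]; rewrite sub1E memvB ?sH.
rewrite (@img_cyc _ _ _ N phi phi); last by move=> y; rewrite !sub1E linearB.
rewrite cyc_sub1 (@dim_cyc_nilp _ _ _ _ m.*2) -?iterSr //= ?odd_double //.
by apply: contraNneq fv => /= ->; rewrite (polar0l quadQ).
Qed.

(** [s] and [- s] differ by [2 s], which is injective on a space of dimension [2m + 1]. *)
Lemma odd_flexible m v : (2%:R : K) != 0 ->
  iter m.*2.+1 N v = 0 -> Q (iter m N v) != 0 -> exists H, flexible_summand H.
Proof.
move=> nz2 Nv Qv.
have fv : f (iter m.*2 N v) v != 0.
  have := @polar_top m m v v; rewrite addnn => /(_ Nv).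
  rewrite (polarxx quadQ) => E; have : Q (iter m N v) *+ 2 != 0.
    by rewrite -mulr_natl mulf_neq0.
  by rewrite E mulf_eq0 negb_or => /andP[].
have nd := unipotent_cyc_nondeg quadQ ndefQ iphi Nv fv.
have [s sP _] := cyc_inverter ndefQ iphi nd.
exists (cyc phi v), s, (- s); split=> //; [exact: stable_cyc | exact: inverter_opp |].
have kS : (cyc phi v :&: lker (s - - s) = 0)%VS.
  apply/eqP; rewrite -subv0 -(inverter_ker sP) capvS //; apply/subvP=> x.
  rewrite !memv_ker opprK add_lfunE -mulr2n -scaler_nat scaler_eq0.
  by rewrite (negPf nz2).
rewrite limg_dim_eq // cyc_sub1 (@dim_cyc_nilp _ _ _ _ m.*2) //= ?odd_double //.
by apply: contraNneq fv => ->; rewrite (polar0l quadQ).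
Qed.

Local Notation VK := (V * K^o)%type.

(** The functional is given by its graph because its values come from a recursion on generators; the
    hypothesis is their consistency. *)
Lemma represent_functional (L : {vspace VK}) :
  (forall p, p \in L -> p.1 = 0 -> p.2 = 0) ->
  exists w, forall p, p \in L -> f p.1 w = p.2.
Proof.
move=> funL.
pose fst1 : 'Hom(VK, V) := linfun fst.
pose snd1 : 'Hom(VK, K^o) := linfun snd.
pose F := (fst1 \o projv L)%VF.
pose lam := (snd1 \o projv L \o F^-1)%VF.
have lamE p : p \in L -> lam p.1 = p.2.
  move=> zL; have Fz : F p = p.1 by rewrite comp_lfunE projv_id // lfunE.
  have : F ((F^-1)%VF p.1) = p.1.
    by apply: limg_lfunVK; rewrite -Fz memv_img ?memvf.
  rewrite !comp_lfunE lfunE [snd1 _]lfunE /=; set t := projv _ _ => t1.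
  have tL : t \in L by apply: memv_proj.
  apply/eqP; rewrite -subr_eq0; apply/eqP.
  by apply: (funL _ (memvB tL zL)); rewrite /= t1 subrr.
suff [w wP] : exists w, forall x, f x w = lam x.
  by exists w => p pL; rewrite wP lamE.
have [lam0|] := boolP (fullv <= lker lam)%VS.
  exists 0 => x; rewrite (polar0r quadQ).
  by have := subvP lam0 x (memvf x); rewrite memv_ker => /eqP->.
case/subvPn=> x0 _ x0K.
have [w wK fw] := exists_perp_notin quadQ ndefQ x0K.
exists ((lam x0 / f x0 w) *: w) => x; rewrite memv_ker in x0K.
have : x - (lam x / lam x0) *: x0 \in lker lam.
  by rewrite memv_ker linearB linearZ /= -[_ *: lam x0]/(_ * _) divfK // subrr.
move/perpP: wK => wK /wK; rewrite (polarBl quadQ) (polarZl quadQ).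
move/subr0_eq => E; rewrite (polarZr quadQ) E.
rewrite [lam x / _ * _]mulrC mulrA divfK // mulrC divfK //.
Qed.

Section CharacteristicTwo.
Hypothesis two0 : (2%:R : K) = 0.
Variables (m : nat) (v : V).
Hypotheses (Nv : iter m.*2.+1 N v = 0) (Qv : Q (iter m N v) != 0).
Hypothesis Nv_notin : iter m.*2 N v \notin limg (lexp N m.*2.+1).

Let add2K (a : K) : a + a = 0. Proof. by rewrite -mulr2n -mulr_natl two0 mul0r. Qed.
Let add2V (x : V) : x + x = 0.
Proof. by rewrite -mulr2n -scaler_nat two0 scale0r. Qed.
Let polarxx0 x : f x x = 0.
Proof. by rewrite (polarxx quadQ) mulr2n add2K. Qed.

Let theta := theta2 phi.
Let thetaE x : theta x = phi x + phiV x.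
Proof. by rewrite /theta (theta2E quadQ ndefQ iphi) mulr2n add2V subr0. Qed.

Let adjV := iter_phiV_adj quadQ ndefQ iphi.

(* The values prescribed by [f (v, w) = Q v] and
   [f (theta x, w) = f (phi^-1 x, v)] for [x] in [K[theta] v]. *)
Let Theta_linear : linear (fun p : VK => (theta p.1, f (phiV p.1) v) : VK).
Proof.
move=> k [x1 x2] [y1 y2] /=; congr pair; first by rewrite linearP.
by rewrite linearP /= (polarDl quadQ) (polarZl quadQ).
Qed.
Let Theta : 'End(VK) := lmap Theta_linear.
Let ThetaE p : Theta p = (theta p.1, f (phiV p.1) v).
Proof. by rewrite lmapE. Qed.

Let p0 : VK := (v, Q v).

Let iterTheta j : (iter j Theta p0).1 = iter j theta v.
Proof. by elim: j => //= j IH; rewrite ThetaE /= IH. Qed.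

Let commN_phiV x : N (phiV x) = phiV (N x).
Proof. by rewrite (phiV_N quadQ ndefQ iphi). Qed.

Let commN_iterphiV i x : iter i N (phiV x) = phiV (iter i N x).
Proof. by rewrite -iter_comm // => z; rewrite commN_phiV. Qed.

Let iterN_theta i j x :
  iter i N (iter j theta x) = iter j phiV (iter (i + j.*2) N x).
Proof.
elim: j i x => [|j IH] i x; first by rewrite addn0.
rewrite iterSr IH [theta x]comp_lfunE comp_lfunE commN_iterphiV.
by rewrite -iterSr -!iterSr doubleS !addnS.
Qed.

Let T := iter m.*2 N v.
Let NT : N T = 0. Proof. exact: Nv. Qed.
Let phiVT j : iter j phiV T = T.
Proof.
by elim: j => //= j ->; rewrite -{1}(phi_fixed NT) phiK.
Qed.

Let fst_cyc p r : p \in cyc Theta r -> p.1 \in cyc theta r.1.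
Proof.
pose fst1 : 'Hom(VK, V) := linfun fst.
have fstE p' : fst1 p' = p'.1 by rewrite lfunE.
move/(memv_img fst1); rewrite (@img_cyc _ _ _ fst1 Theta theta) ?fstE // => p'.
by rewrite !fstE ThetaE.
Qed.

Let y0 := phiV (N v).

Let iterN_y0 i j : iter i N (iter j theta y0) = iter j.+1 phiV (iter (i + j.*2).+1 N v).
Proof. by rewrite iterN_theta commN_iterphiV -iterSr -iterSr. Qed.

Let limgT a : a *: T \in limg (lexp N m.*2.+1) -> a = 0.
Proof.
move=> aT; apply/eqP/negPn/negP=> a0; case/negP: Nv_notin.
by have := memvZ a^-1 aT; rewrite scalerK.
Qed.

Let limgN i x : x \in limg (lexp N m.*2.+1) -> iter i N x \in limg (lexp N m.*2.+1).
Proof. by case/limg_lexpP=> z ->; apply/limg_lexpP; exists (iter i N z); rewrite -!iterD addnC. Qed.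

Let fTv : f T v = 0.
Proof.
have := @polar_top m m v v; rewrite addnn polarxx0 => /(_ Nv)/esym/eqP.
by rewrite mulf_eq0 signr_eq0 => /eqP.
Qed.

Let cyc0 (W : vectType K) (g : 'End(W)) p : p \in cyc g 0 -> p = 0.
Proof.
move=> pC; apply/eqP; rewrite -memv0; apply: (subvP (cyc_min _ _)) pC; first exact: mem0v.
by move=> z; rewrite !memv0 => /eqP->; rewrite linear0.
Qed.

Let killed i j q u : q \in cyc theta (iter j theta u) -> iter (i + j.*2) N u = 0 ->
  iter i N q = 0.
Proof.
move=> qC Nu; apply: (cyc_theta2_iter_eq0 quadQ ndefQ iphi) qC _.
by rewrite iterN_theta Nu iter0_lin.
Qed.

Let Ny0 i : (m.*2 <= i)%N -> iter i N y0 = 0.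
Proof.
move=> lei; rewrite /y0 commN_iterphiV -iterSr (iter_eq0_leq _ Nv) ?linear0 //.
Qed.

(** [N^(2d)] sends [theta^j v] to [T] and kills all terms of greater height; as [T] is not in the
    image of [N^(2m+1)], its coefficient vanishes. In [lead_q] the power [N^(2d+1)] does this for
    [theta^j y0]. *)
Let lead_p d j a p' q : (d.*2 + j.*2 = m.*2)%N ->
  p' \in cyc Theta (iter j.+1 Theta p0) -> q \in cyc theta (iter j theta y0) ->
  (a *: iter j Theta p0 + p').1 + q \in limg (lexp N m.*2.+1) -> a = 0.
Proof.
move=> mE /fst_cyc; rewrite iterTheta => p'C qC /(limgN d.*2).
rewrite !iterD_lin iterZ_lin /= iterTheta iterN_theta mE -/T phiVT.
rewrite (killed p'C); last by apply: (iter_eq0_leq _ Nv); rewrite doubleS !addnS mE.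
by rewrite (killed qC) ?mE ?Ny0 // !addr0; apply: limgT.
Qed.

Let lead_q d j b p q' : (d.*2.+2 + j.*2 = m.*2)%N ->
  p \in cyc Theta (iter j.+1 Theta p0) ->
  q' \in cyc theta (iter j.+1 theta y0) ->
  p.1 + (b *: iter j theta y0 + q') \in limg (lexp N m.*2.+1) -> b = 0.
Proof.
move=> mE /fst_cyc; rewrite iterTheta => pC q'C /(limgN d.*2.+1).
rewrite !iterD_lin iterZ_lin iterN_y0 -addSn mE -/T phiVT.
rewrite (killed pC); last by apply: (iter_eq0_leq _ Nv); rewrite doubleS 2!addnS -addSn mE.
rewrite (killed q'C) ?Ny0 //; last by rewrite doubleS 2!addnS -addSn mE leqnSn.
by rewrite add0r addr0; apply: limgT.
Qed.

(** The vectors [theta^j v] and [theta^j y0] have heights [2j] and [2j + 1], so the coefficients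
    vanish alternately from the bottom. What remains is generated by [Theta^(m+1) p0], which is zero
    because [f T v = 0]. *)
Let Theta_valuation d j p q : m = (j + d)%N ->
  p \in cyc Theta (iter j Theta p0) -> q \in cyc theta (iter j theta y0) ->
  p.1 + q \in limg (lexp N m.*2.+1) -> p.2 = 0.
Proof.
elim: d j p q => [|d IH] j p q mE /cyc_recP[a [p' [p'C ->]]] qC pq.
  have a0 : a = 0 by apply: (lead_p (d := 0)) p'C qC pq; rewrite mE addn0.
  rewrite a0 scale0r add0r (cyc0 (p := p') (g := Theta)) //.
  suff <- : Theta (iter j Theta p0) = 0 by [].
  rewrite ThetaE !iterTheta; congr pair.
    rewrite -[theta _]/(iter 0 N (iter j.+1 theta v)) iterN_theta.
    rewrite (iter_eq0_leq _ Nv) ?iter0_lin //.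
    by rewrite mE addn0 doubleS.
  have jm : j = m by rewrite mE addn0.
  rewrite -[iter j theta v]/(iter 0 N (iter j theta v)) iterN_theta add0n jm -/T.
  by rewrite phiVT -[phiV T]/(iter 1 phiV T) phiVT fTv.
have mE2 : (d.*2.+2 + j.*2 = m.*2)%N by rewrite mE addnC doubleD doubleS.
have a0 : a = 0 by apply: (lead_p (d := d.+1)) p'C qC pq; rewrite doubleS.
move: qC pq => /cyc_recP[b [q' [q'C ->]]] pq.
rewrite a0 scale0r add0r in pq *.
have b0 : b = 0 by apply: lead_q mE2 p'C q'C pq.
apply: (IH j.+1 p' q') p'C q'C _; first by rewrite mE addnS addSn.
by move: pq; rewrite b0 scale0r add0r.
Qed.

Let oppV (x : V) : - x = x. Proof. by apply/esym/eqP; rewrite -addr_eq0 add2V. Qed.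

(** Up to sign this is [Q (N^m v)]: for [m > 0] the adjoint balances the powers of [N], leaving
    [f a (N a)] with [a = N^(m-1) v]. *)
Let Theta_top : (iter m Theta p0).2 != 0.
Proof.
case: m Qv => [//|k]; rewrite !iterS ThetaE /= iterTheta.
rewrite -[iter k theta v]/(iter 0 N (iter k theta v)) iterN_theta add0n -addnn iterD.
set a := iter k N v => Qa.
have psiE i x : iter i (- phiV : 'End(V)) x = iter i phiV x.
  by elim: i => //= i ->; rewrite opp_lfunE oppV.
have comm i x : iter i phiV (iter k N x) = iter k N (iter i phiV x).
  by apply: iter_comm2 => z; rewrite commN_phiV.
rewrite -iterS comm adj_iter_sub1 // psiE -/a iterSr.
have iV := isom_inv quadQ ndefQ iphi.
have fk i x y : f (iter i phiV x) (iter i phiV y) = f x y.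
  by elim: i => //= i; rewrite (isomP iV).
rewrite fk isom_adjV // -[phi a](subrK a).
by rewrite (polarDr quadQ) -sub1E polar_sub1 polarxx0 addr0 oppr_eq0.
Qed.

(** Orthogonality to [K[theta] phi^-1 N v] allows the involution [w -> phi w]. The last two
    conditions are what [w -> w + v], with [v] fixed, needs: [Q (w + v) = Q w] forces [f v w = Q v],
    and [f (phi^i v) w = f (phi^-i v) (w + v)] gives the other one. *)
Lemma exists_reflecting_partner : exists w,
  [/\ iter m.*2.+1 N w = 0, f (iter m.*2 N v) w != 0,
      forall x, x \in cyc theta (phiV (N v)) -> f x w = 0, f v w = Q v
    & forall i, f (iter i phi v + iter i phiV v) w = f (iter i phi v) v].
Proof.
have lin0 : linear (fun x => (x, 0) : VK).
  by move=> k x y; congr pair; apply/esym; rewrite addr0; apply: mulr0.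
pose inj0 := lmap lin0; have inj0E x : inj0 x = (x, 0) by rewrite lmapE.
pose L := (cyc Theta p0 + (inj0 @: (cyc theta y0 + limg (lexp N m.*2.+1))))%VS.
have [p|w wL] := @represent_functional L.
  case/memv_addP=> p1 p1C [_ /memv_imgP[_ /memv_addP[y yC [z zI ->]] ->] ->].
  rewrite inj0E /= addr0 => E.
  apply: (Theta_valuation (d := m) (j := 0) (q := y)) => //.
  have -> : p1.1 + y = - z by apply/eqP; rewrite -addr_eq0 -addrA E.
  by rewrite memvN.
have wp p : p \in cyc Theta p0 -> f p.1 w = p.2.
  by move=> pC; apply: wL; rewrite (subvP (addvSl _ _)).
have w0 x : x \in (cyc theta y0 + limg (lexp N m.*2.+1))%VS -> f x w = 0.
  move=> xU; have := wL (x, 0); apply; rewrite (subvP (addvSr _ _)) //.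
  by rewrite -inj0E memv_img.
have wT j : (j <= m)%N -> f (iter j theta v) w = (iter j Theta p0).2.
  move=> _; rewrite -iterTheta wp //; apply: iter_stable (mem_cyc _ _) => p.
  exact: stable_cyc.
exists w; split.
- have : w \in perp quadQ (limg (lexp N m.*2.+1)).
    by apply/perpP=> x xI; apply: w0; rewrite (subvP (addvSr _ _)).
  by rewrite perp_limg_iter // mem_lker_lexp => /eqP.
- have := wT m (leqnn m).
  rewrite -[iter m theta v]/(iter 0 N (iter m theta v)) iterN_theta add0n -/T phiVT => ->.
  exact: Theta_top.
- by move=> x xC; apply: w0; rewrite (subvP (addvSl _ _)).
- exact: (wp _ (mem_cyc _ _)).
have fself j : f (iter j phi v) v = f (iter j phiV v) v by rewrite -adjV polarC.
move=> i; pose S i : VK := (iter i phi v + iter i phiV v, f (iter i phi v) v).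
(* The pairs of argument and value obey the recurrence of [reciprocal_mem], now with [Theta] in
   place of [theta]. *)
suff [] : S i \in cyc Theta p0 /\ S i.+1 \in cyc Theta p0 by move/wp.
elim: i => [|i [S0 S1]].
  split; first by rewrite /S /= add2V polarxx0 mem0v.
  have -> : S 1%N = Theta p0.
    rewrite ThetaE /S /= thetaE; congr pair.
    exact: (fself 1%N).
  by rewrite stable_cyc ?mem_cyc.
split=> //; have -> : S i.+2 = Theta (S i.+1) - S i.
  rewrite ThetaE /S /= thetaE !linearD /= phiK phiVK; congr pair.
    rewrite [iter i phi v + phiV _]addrC addrACA.
    by rewrite [iter i phiV v + _]addrC addrK.
  rewrite (polarDl quadQ) addrAC subrr add0r; exact: (fself i.+2).
by rewrite memvB // stable_cyc.
Qed.

(** The difference of the two involutions kills [v] and sends [w] to [y = N w - v]. Its image is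
    [cyc phi y], of dimension [2m + 1] because [N^(2m) y = - N^(2m) v]. *)
Lemma reflecting_flexible : exists H, flexible_summand H.
Proof.
have [w [Nw fTw fYw fvw fCw]] := exists_reflecting_partner.
have bi := bicyclic_inverter quadQ ndefQ iphi Nv Nw fTw fTv.
rewrite odd_double in bi; have [s1 s1P [s1v s1w]] := bi fYw.
have nd := unipotent_pair_nondeg quadQ ndefQ iphi Nv Nw fTw fTv.
set H := (cyc phi v + cyc phi w)%VS in s1P nd.
have sH : stable H phi by apply: stable_add; apply: stable_cyc.
have adj := iter_phi_adj quadQ ndefQ iphi.
have fCw' i : f (iter i phiV v) w = f (iter i phi v) w + f (iter i phi v) v.
  by rewrite -fCw (polarDl quadQ) addrA add2K add0r.
have fself x j : f x (iter j phi x) = f x (iter j phiV x) by rewrite adjV polarC.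
have [|||||||||s2 s2P [s2v s2w]] := @pair_inverter _ _ _ quadQ ndefQ phi iphi v v w (w + v).
- by [].
- by rewrite (quadD Q) polarC fvw -addrA add2K addr0.
- by move=> i; rewrite fself.
- move=> i; rewrite iterD_lin (polarDr quadQ) !adjV adj fCw'.
  by [].
- move=> i; rewrite (polarDl quadQ) [f v _]adjV [f w (iter i phiV v)]polarC.
  by rewrite fCw' -addrA add2K addr0 polarC.
- move=> i; rewrite iterD_lin (polarDl quadQ) !(polarDr quadQ) fself.
  rewrite [f w (iter i phiV v)]polarC fCw' [f v (iter i phiV w)]adjV.
  by rewrite [f v (iter i phiV v)]adjV -addrA add2K addr0.
- by rewrite (subvP (addvSl _ _)) ?mem_cyc.
- have -> : (w + v, w) = (v, v) + (w, w + v) :> V * V.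
    by congr pair; rewrite addrC // -addrA add2V addr0.
  by rewrite memv_add ?mem_cyc.
- exact: nd.
exists H, s1, s2; split=> //.
pose y := N w - v; set D := s1 - s2.
have Dv : D v = 0 by rewrite add_lfunE opp_lfunE s1v s2v subrr.
have Dw : D w = y.
  by rewrite add_lfunE opp_lfunE s1w s2w opprD addrA -sub1E.
have DphiD x : x \in H -> D (phi x) = phiV (D x).
  move=> xH; have [_ _ rev1 _] := s1P; have [_ _ rev2 _] := s2P.
  rewrite -[LHS]phiK; congr (phiV _).
  by rewrite !add_lfunE !opp_lfunE linearB /= rev1 // rev2.
have sHV : stable H phiV by apply: stable_inv => //; apply: isom_ker iphi.
have -> : (D @: H = cyc phi y)%VS.
  apply/eqP; rewrite eqEsubv; apply/andP; split; last first.
    apply: cyc_min.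
      by rewrite -Dw memv_img // (subvP (addvSr _ _)) ?mem_cyc.
    move=> _ /memv_imgP[x xH ->]; have := DphiD _ (sHV _ xH).
    by rewrite phiVK => ->; rewrite phiVK memv_img ?sHV.
  have sV : stable (cyc phi y) phiV.
    by apply: stable_inv; [apply: isom_ker iphi | apply: stable_cyc].
  suff DH x : x \in H -> x \in H /\ D x \in cyc phi y.
    by apply/subvP=> _ /memv_imgP[x /DH[_ Dx] ->].
  rewrite {1}/H -cyc_addW; move: x; apply: cycs_ind.
  - by rewrite !linear0 !mem0v.
  - by move=> x z [xH Dx] [zH Dz]; rewrite linearD !memvD.
  - move=> _ /memv_addP[_ /vlineP[a ->] [_ /vlineP[b ->] ->]].
    rewrite linearD !linearZ /= Dv scaler0 add0r Dw memvZ ?mem_cyc //.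
    by rewrite memv_add // memvZ ?mem_cyc.
  - by move=> x [xH Dx]; rewrite sH // DphiD // sV.
have Ny : iter m.*2.+1 N y = 0.
  by rewrite iterB_lin -iterSr iterS Nw linear0 Nv subrr.
rewrite cyc_sub1 (dim_cyc_nilp Ny) ?oddS ?odd_double //.
rewrite iterB_lin -iterSr Nw sub0r oppr_eq0; apply: contraNneq fTw => TE.
by rewrite TE (polar0l quadQ).
Qed.

End CharacteristicTwo.

Lemma not_nonflexible_summand : ~ nonflexible Q phi -> exists H, flexible_summand H.
Proof.
move=> NF; apply: NNPP => noH; apply: NF => m v Nv.
have no_even k u : iter k.*2 N u = 0 -> Q (iter k N u) = 0.
  move=> Nu; apply/eqP/negPn/negP=> Qu; apply: noH; exact: even_flexible Nu Qu.
apply/eqP/negPn/negP=> Qv; have [two0|nz2] := eqVneq (2%:R : K) 0; last first.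
  by apply: noH; apply: odd_flexible nz2 Nv Qv.
(* If [N^(2m) v = N^(2m+1) u], the even case applies to [u] and to [v - N u]. The cross term
   [f (N^m v) (N^(m+1) u)] equals [f (N^m v) (N^m v)], zero in characteristic 2, so [Q (N^m v)]
   would vanish. *)
have [/limg_lexpP[u NvE]|NvN] := boolP (iter m.*2 N v \in limg (lexp N m.*2.+1)); last first.
  by apply: noH; apply: (reflecting_flexible two0 Nv Qv NvN).
have Nu : iter m.+1.*2 N u = 0.
  by rewrite doubleS iterS -NvE -iterS.
have QNu := no_even _ _ Nu.
have QvNu : Q (iter m N (v - N u)) = 0.
  by apply: no_even; rewrite iterB_lin -iterSr NvE subrr.
case/eqP: Qv; move: QvNu; rewrite iterB_lin (quadB quadQ) -iterSr QNu addr0.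
have := @polar_top m m.+1 u v; rewrite addnS addnn -doubleS => /(_ Nu) ->.
have := @polar_top m m v v; rewrite addnn -NvE (polarxx quadQ) => /(_ Nv) <-.
by rewrite -mulr_natl two0 mul0r subr0.
Qed.


End Flexible.

(** * Choosing an inverting involution of even parity *)

Section Main.
Variables (K : fieldType) (V : vectType K) (Q : V -> K).
Hypotheses (quadQ : quadratic_form Q) (ndefQ : nondefective Q).
Implicit Types (phi psi sigma : 'End(V)) (H : {vspace V}).

Lemma flexible_summand_opp phi H :
  flexible_summand quadQ (- phi) H -> flexible_summand quadQ phi H.
Proof.
case=> s1 [s2 [nH sH s1P s2P oddH]]; exists s1, s2; split=> //.
- by move=> x /sH; rewrite opp_lfunE memvN.
- exact: inverter_on_opp.
- exact: inverter_on_opp.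
Qed.

Lemma inverter_isometry phi sigma :
  inverter_on Q phi fullv sigma -> isometry_of Q sigma.
Proof. by case=> _ _ _ iso x; rewrite iso ?memvf. Qed.

(** Both involutions of the summand are extended by the same one on its orthogonal, so the two
    extensions still have opposite parities and one of them is even. *)
Lemma flexible_even_inverter phi H : isometry_of Q phi ->
  flexible_summand quadQ phi H -> exists2 sigma,
    inverter_on Q phi fullv sigma & ~~ odd (\dim (limg (sigma - \1%VF))).
Proof.
move=> iphi [s1 [s2 [nH sH s1P s2P oddH]]]; pose H' := perp quadQ H.
have sH' : stable H' phi by apply: perp_stable.
have [t tP] := exists_inverter (quad_restrP quadQ H')
  (quad_restr_ndef (nondeg_perp ndefQ nH)) (isometry_restr sH' iphi).
have {}tP := transport_inverter sH' tP.
have [g1 [g1P g1H g1H']] := glue_inverter ndefQ iphi nH sH s1P tP.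
have [g2 [g2P g2H g2H']] := glue_inverter ndefQ iphi nH sH s2P tP.
have := parity_triangle quadQ ndefQ (inverter_isometry g1P) (inverter_isometry g2P).
have -> : limg (g1 - g2) = ((s1 - s2) @: H)%VS.
  rewrite -(nondeg_add ndefQ nH) limgD.
  have -> : ((g1 - g2) @: perp quadQ H = 0)%VS.
    apply/eqP; rewrite -subv0; apply/subvP=> _ /memv_imgP[x xH ->].
    by rewrite add_lfunE opp_lfunE g1H' // g2H' // subrr mem0v.
  rewrite addv0; apply: eq_in_limg => x xH.
  by rewrite !add_lfunE !opp_lfunE g1H // g2H.
rewrite oddH; case: (boolP (odd (\dim (limg (g1 - \1%VF))))) => [_|even1 _].
  by rewrite addTb => even2; exists g2; rewrite -?even2.
by exists g1.
Qed.

Lemma limg_sub_comp psi sigma : (sigma \o sigma)%VF = \1%VF ->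
  \dim (limg ((sigma \o psi)%VF - \1%VF)) = \dim (limg (psi - sigma)).
Proof.
move=> ss; have -> : (sigma \o psi)%VF - \1%VF = (sigma \o (psi - sigma))%VF.
  by rewrite comp_lfunDr comp_lfunNr ss.
rewrite limg_comp limg_dim_eq //; apply/eqP; rewrite -subv0; apply/subvP=> x.
rewrite memv_cap memv_ker memv0 => /andP[_ /eqP sx].
by rewrite -[x]id_lfunE -ss comp_lfunE sx linear0.
Qed.

Lemma even_inverter phi psi : isometry_of Q phi -> isometry_of Q psi ->
  ~~ odd (\dim (limg (psi - \1%VF))) -> (forall x, phi (psi (phi x)) = psi x) ->
  exists2 sigma, inverter_on Q phi fullv sigma
    & ~~ odd (\dim (limg (sigma - \1%VF))).
Proof.
move=> iphi ipsi evenpsi revpsi.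
have [NF1|] := classic (nonflexible Q phi); last first.
  move/(not_nonflexible_summand quadQ ndefQ iphi) => [H]; exact: flexible_even_inverter.
have [NF2|] := classic (nonflexible Q (- phi)); last first.
  move/(not_nonflexible_summand quadQ ndefQ (isom_opp quadQ iphi)) => [H].
  by move/flexible_summand_opp; apply: flexible_even_inverter.
have [sigma sP] := exists_inverter quadQ ndefQ iphi.
have isig := inverter_isometry sP.
have [_ inv rev _] := sP.
have ss : (sigma \o sigma)%VF = \1%VF.
  by apply/lfunP=> x; rewrite comp_lfunE id_lfunE inv ?memvf.
exists sigma => //.
(* Both [sigma] and [psi] invert [phi], so their product centralizes it and is even; by
   multiplicativity [sigma] has the parity of [psi]. *)
have comm x : (sigma \o psi)%VF (phi x) = phi ((sigma \o psi)%VF x).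
  rewrite !comp_lfunE -[psi x]revpsi rev ?memvf //.
have := centralizer_even quadQ ndefQ iphi (isom_comp isig ipsi) comm NF1 NF2.
by rewrite limg_sub_comp // (parity_triangle quadQ ndefQ) // (negPf evenpsi).
Qed.

End Main.

Theorem theorem1p8 (K : fieldType) (V : vectType K) (Q : V -> K)
    (quadQ : quadratic_form Q) (ndefQ : nondefective Q)
    (phi : 'End(V)) (SOphi : special_orthogonal_group Q phi)
    (revphi : reversible_in (special_orthogonal_group Q) phi) :
  bireflectional_in (special_orthogonal_group Q) phi.
Proof.
have [[kphi iphi] evenphi] := SOphi.
have [psi [[kpsi ipsi] evenpsi] psiE] := revphi.
have phipsi x : phi (psi (phi x)) = psi x.
  have /lfunP/(_ (psi x)) := psiE; rewrite !comp_lfunE lker0_lfunK ?kpsi // => ->.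
  by rewrite lker0_lfunVK ?kphi.
have [sigma sP evens] := even_inverter quadQ ndefQ iphi ipsi evenpsi phipsi.
have isig := inverter_isometry sP; have [_ inv rev _] := sP.
have ss : (sigma \o sigma)%VF = \1%VF.
  by apply/lfunP=> x; rewrite comp_lfunE id_lfunE inv ?memvf.
have SOsig : special_orthogonal_group Q sigma.
  by split=> //; apply: isom_orthogonal.
(* The second factor squares to 1 by [phi sigma phi = sigma], and it is even because [phi] and
   [sigma] are. *)
exists sigma, (sigma \o phi)%VF; split.
- by split.
- split; last by apply/lfunP=> x; rewrite !comp_lfunE rev ?memvf // -comp_lfunE ss.
  split; first by apply: isom_orthogonal => //; apply: isom_comp.
  by rewrite limg_sub_comp // (parity_triangle quadQ ndefQ) // (negPf evenphi) (negPf evens).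
- by rewrite comp_lfunA ss comp_lfun1l.
Qed.
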